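(* Let $(\Omega,\nu)$ be a $\sigma$-finite measure space with $L^p(\Omega,\nu)\neq\{0\}$, let $1<p<\infty$, and let $T$ be a contraction on the complex space $L^p(\Omega,\nu)$ which is a Ritt operator, with $C=C_{\mathrm R}(T)$. Let $\zeta\in\mathbb T\setminus\{1\}$. Then $$\sup_{n\ge1}\|(\zeta-T^n)^{-1}\|_{p\to p}\le1+CK_{p^*}(\zeta),\qquad p^*:=\min\{p,p'\},\quad\frac1p+\frac1{p'}=1,$$ where, for $1<s<\infty$, $$K_s(\zeta):=2^{1/s}\left[\left(\frac{\pi}{2|\zeta-1|}\right)^s+\frac{Z(s)}{4^s}\right]^{1/s},\qquad Z(s):=\sum_{k\ge1}k^{-s}.$$ Consequently, $$\sup_{n\ge1}\|I-T^n\|_{p\to p}\le2\left(1-\delta_{L^p}\left(\frac1{1+CK_{p^*}(-1)}\right)\right)<2 .$$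
   Context: $\mathbb D$ is the open unit disc, $\mathbb T$ the unit circle. A bounded operator $T$ is a Ritt operator if $\sigma(T)\subset\overline{\mathbb D}$ and its Ritt constant $C_{\mathrm R}(T):=\sup_{|\lambda|>1}|\lambda-1|\,\|(\lambda-T)^{-1}\|$ is finite. The modulus of convexity of $X=L^p(\Omega,\nu)$ is $\delta_{X}(\varepsilon):=\inf\{1-\|\frac{x+y}2\|:\|x\|\le1,\|y\|\le1,\|x-y\|\ge\varepsilon\}$, $0<\varepsilon\le2$. *)

(* Defs.v *)
From HB Require Import structures.
From mathcomp Require Import all_boot all_order all_algebra ring_quotient.
From mathcomp Require Import all_classical all_reals all_analysis measurable_realfun.
From mathcomp Require Import complex.

Set Implicit Arguments.
Unset Strict Implicit.
Unset Printing Implicit Defensive.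

Import Order.TTheory GRing.Theory Num.Theory.
Import numFieldNormedType.Exports.

Local Open Scope classical_set_scope.
Local Open Scope ring_scope.
Local Open Scope complex_scope.
Local Open Scope quotient_scope.

(* In a normed module over R[i] the library norm `|x| is an element of R[i]
   lying on the real axis; rnorm x is the same norm as an element of R. *)
Definition rnorm (R : realType) (V : normedZmodType R[i]) (x : V) : R :=
  complex.Re `|x|.

Section ComplexModulus.
Context {R : realType}.

Lemma rnormE (z : R[i]) :
  rnorm z = Num.sqrt (complex.Re z ^+ 2 + complex.Im z ^+ 2).
Proof. by rewrite /rnorm normc_def. Qed.

Lemma rnormK (V : normedZmodType R[i]) (x : V) : (rnorm x)%:C = `|x|.
Proof. by rewrite RRe_real ?normr_real. Qed.

Lemma rnorm_ge0 (V : normedZmodType R[i]) (x : V) : 0 <= rnorm x.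
Proof. by rewrite -ler0c rnormK. Qed.

Lemma ler_rnormD (V : normedZmodType R[i]) (x y : V) :
  rnorm (x + y) <= rnorm x + rnorm y.
Proof. by rewrite -lecR rmorphD/= !rnormK ler_normD. Qed.

Lemma rnormM (x y : R[i]) : rnorm (x * y) = rnorm x * rnorm y.
Proof. by apply: complexI; rewrite rmorphM/= !rnormK normrM. Qed.

Lemma rnorm0 (V : normedZmodType R[i]) : rnorm (0 : V) = 0.
Proof. by rewrite /rnorm normr0. Qed.

Lemma rnorm0_eq0 (V : normedZmodType R[i]) (x : V) : rnorm x = 0 -> x = 0.
Proof. by move=> x0; apply/eqP; rewrite -normr_eq0 -rnormK x0. Qed.

End ComplexModulus.

Section ComplexLp.
Context d (T : measurableType d) (R : realType).
Variable mu : {measure set T -> \bar R}.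
Implicit Types f g : T -> R[i].

Definition cmeasurable f :=
  measurable_fun [set: T] (fun t => complex.Re (f t)) /\
  measurable_fun [set: T] (fun t => complex.Im (f t)).

Lemma cmeasurable_rnorm f : cmeasurable f ->
  measurable_fun [set: T] (fun t => rnorm (f t)).
Proof.
move=> [mR mI]; rewrite (_ : (fun _ => _) = Num.sqrt \o
  (fun t => complex.Re (f t) ^+ 2 + complex.Im (f t) ^+ 2)); last first.
  by apply/funext => t; rewrite rnormE.
apply: measurableT_comp; first exact: continuous_measurable_fun (@sqrt_continuous R).
by apply: measurable_funD; exact: measurable_funX.
Qed.

Lemma cmeasurable0 : cmeasurable 0.
Proof. by split; exact: measurable_cst. Qed.

Lemma cmeasurable_lin (a : R[i]) f g :
  cmeasurable f -> cmeasurable g -> cmeasurable (a *: f + g).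
Proof.
case: a => a b [fR fI] [gR gI]; split.
- rewrite (_ : (fun _ => _) = (fun t => (a * complex.Re (f t) -
    b * complex.Im (f t)) + complex.Re (g t))); last first.
    apply/funext => t; rewrite /GRing.add/= /GRing.scale/=.
    by rewrite /GRing.scale/=; case: (f t) (g t) => [? ?] [? ?].
  apply: measurable_funD => //; apply: measurable_funB;
    exact: measurable_funM.
- rewrite (_ : (fun _ => _) = (fun t => (a * complex.Im (f t) +
    b * complex.Re (f t)) + complex.Im (g t))); last first.
    apply/funext => t; rewrite /GRing.add/= /GRing.scale/=.
    by rewrite /GRing.scale/=; case: (f t) (g t) => [? ?] [? ?].
  by apply: measurable_funD => //; apply: measurable_funD;
    exact: measurable_funM.
Qed.

Definition cLnorm (p : R) f : \bar R :=
  'N[mu]_p%:E[EFin \o (fun t => rnorm (f t))].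

Section exponent.
Variables (p : R) (p1 : 1 <= p).

Let p0 : 0 < p. Proof. exact: lt_le_trans p1. Qed.

Lemma cLnorm_mono (u v : T -> R) : measurable_fun setT u ->
  measurable_fun setT v -> (forall t, 0 <= u t <= v t) ->
  ('N[mu]_p%:E[EFin \o u] <= 'N[mu]_p%:E[EFin \o v])%E.
Proof.
move=> mu_ mv uv; rewrite unlock.
have mpow (w : T -> R) : measurable_fun setT w ->
    measurable_fun setT (fun x => `|(EFin \o w) x| `^ p)%E.
  move=> mw; apply/measurable_EFinP.
  apply: (@measurableT_comp _ _ _ _ _ _ (@powR R ^~ p)) => //.
  exact: measurableT_comp.
apply: gt0_ler_poweR.
- by rewrite invr_ge0 ltW.
- by rewrite in_itv/= leey integral_ge0.
- by rewrite in_itv/= leey integral_ge0.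
apply: ge0_le_integral => //.
- by move=> t _; exact: poweR_ge0.
- exact: mpow.
- exact: mpow.
move=> t _; have /andP[u0 uv'] := uv t.
have v0 := le_trans u0 uv'; rewrite /= lee_fin !ger0_norm//.
by apply: ge0_ler_powR; rewrite ?nnegrE// ltW.
Qed.

Lemma cLnormD f g : cmeasurable f -> cmeasurable g ->
  (cLnorm p (f + g)%R <= cLnorm p f + cLnorm p g)%E.
Proof.
move=> mf mg; have mfn := cmeasurable_rnorm mf; have mgn := cmeasurable_rnorm mg.
apply: le_trans (eminkowski mu mfn mgn _); last by rewrite lee_fin.
apply: cLnorm_mono => //.
- apply: cmeasurable_rnorm.
  by rewrite -[f]scale1r; exact: cmeasurable_lin.
- exact: measurable_funD.
- by move=> t; rewrite rnorm_ge0 ler_rnormD.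
Qed.

Lemma cLnormZ (a : R[i]) f : cmeasurable f -> (cLnorm p f < +oo)%E ->
  cLnorm p (a *: f) = ((rnorm a)%:E * cLnorm p f)%E.
Proof.
move=> mf ffin; have mfn := cmeasurable_rnorm mf.
have fL : (fun t => rnorm (f t)) \in Lfun mu p%:E.
  by apply/andP; split; rewrite inE.
have p1' : (1 <= p%:E)%E by rewrite lee_fin.
have := LnormZ (Lfun_Sub p1' fL) (rnorm a).
rewrite Lfun_valP ger0_norm ?rnorm_ge0// => <-.
apply: eq_Lnorm => t /=; congr EFin.
exact: rnormM.
Qed.

Lemma cLnorm0 : cLnorm p 0 = 0%E.
Proof.
rewrite /cLnorm (_ : EFin \o _ = cst 0%E); last first.
  by apply/funext => t /=; rewrite [X in rnorm X](_ : _ = 0)// rnorm0.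
by rewrite Lnorm0// gt_eqF.
Qed.

Lemma cLnorm_ge0 f : (0 <= cLnorm p f)%E.
Proof. exact: Lnorm_ge0. Qed.

Lemma cLnorm_eq0 f : cmeasurable f -> cLnorm p f = 0%E ->
  \forall t \ae mu, f t = 0.
Proof.
move=> mf f0; have mfn := cmeasurable_rnorm mf.
have /measurable_EFinP mfn' := mfn.
have := Lnorm_eq0_eq0 mfn' _ f0; rewrite lte_fin => /(_ p0).
by apply: filterS => t /(_ I)[] /rnorm0_eq0.
Qed.

Lemma cLnorm_ae f g : cmeasurable f -> cmeasurable g ->
  (\forall t \ae mu, f t = g t) -> cLnorm p f = cLnorm p g.
Proof.
move=> mf mg fg; rewrite /cLnorm unlock; congr (_ `^ _)%E.
have mpow (w : T -> R) : measurable_fun setT w ->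
    measurable_fun setT (fun x => `|(EFin \o w) x| `^ p)%E.
  move=> mw; apply/measurable_EFinP.
  apply: (@measurableT_comp _ _ _ _ _ _ (@powR R ^~ p)) => //.
  exact: measurableT_comp.
apply: ae_eq_integral => //.
- exact/mpow/cmeasurable_rnorm.
- exact/mpow/cmeasurable_rnorm.
- by apply: filterS fg => t fgt _ /=; rewrite fgt.
Qed.

(* p-integrable complex functions, before identification almost everywhere *)
Definition cLfun : {pred T -> R[i]} :=
  [pred f | `[< cmeasurable f /\ (cLnorm p f < +oo)%E >]].

Lemma cLfun_submod_closed : submod_closed cLfun.
Proof.
split; first by apply/asboolP; split; [exact: cmeasurable0 | rewrite cLnorm0].
move=> a f g /asboolP[mf ff] /asboolP[mg fg]; apply/asboolP; split.
  exact: cmeasurable_lin.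
have maf : cmeasurable (a *: f).
  rewrite -[X in cmeasurable X]addr0.
  by apply: cmeasurable_lin => //; exact: cmeasurable0.
apply: le_lt_trans (cLnormD maf mg) _.
by rewrite lte_add_pinfty// cLnormZ// lte_mul_pinfty// lee_fin rnorm_ge0.
Qed.

HB.instance Definition _ := GRing.isSubmodClosed.Build R[i] (T -> R[i]) cLfun
  cLfun_submod_closed.

(* h is a parameter, as in the library's LfunType, because the closure of cLfun
   under addition, hence the module structure, needs 1 <= p *)
Record cLfunType (h : 1 <= p) :=
  CLfun { cLfun_val :> T -> R[i] ; _ : cLfun_val \in cLfun }.
Local Notation cLfunp := (cLfunType p1).

HB.instance Definition _ := [isSub for @cLfun_val p1].
HB.instance Definition _ := [Choice of cLfunp by <:].
HB.instance Definition _ := [SubChoice_isSubLmodule of cLfunp by <:].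

Lemma cLfunP (f : cLfunp) : cmeasurable f /\ (cLnorm p f < +oo)%E.
Proof. exact/asboolP/(valP f). Qed.

Definition cLnull : {pred cLfunp} :=
  [pred f : cLfunp | `[< \forall t \ae mu, f t = 0 >]].

Lemma cLnull_zmod_closed : zmod_closed cLnull.
Proof.
split; first by apply/asboolP; exact: nearW.
move=> f g /asboolP f0 /asboolP g0; apply/asboolP.
by apply: filterS2 f0 g0 => t f0 g0; rewrite [LHS](_ : _ = f t - g t)// f0 g0 subr0.
Qed.

HB.instance Definition _ := GRing.isZmodClosed.Build cLfunp cLnull
  cLnull_zmod_closed.

Definition cLp : Type := Quotient.quot cLnull.

HB.instance Definition _ := GRing.Zmodule.on cLp.
HB.instance Definition _ := EqQuotient.on cLp.

Lemma cLp_eqP (f g : cLfunp) :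
  reflect (\forall t \ae mu, f t = g t) (f == g %[mod cLp]).
Proof.
rewrite -Quotient.idealrBE; apply: (iffP (asboolP _)); apply: filterS => t.
  by move/eqP; rewrite [X in X == 0](_ : _ = f t - g t)// subr_eq0 => /eqP.
by move=> fg; rewrite [LHS](_ : _ = f t - g t)// fg subrr.
Qed.

Lemma cLp_repr (f : cLfunp) : \forall t \ae mu, repr (\pi_cLp f) t = f t.
Proof. by apply/cLp_eqP; rewrite reprK. Qed.

Definition cLp_scale (a : R[i]) (x : cLp) : cLp := \pi_cLp (a *: repr x).

Lemma pi_cLpZ a (f : cLfunp) : cLp_scale a (\pi_cLp f) = \pi_cLp (a *: f).
Proof.
apply/eqP/cLp_eqP; apply: filterS (cLp_repr f) => t ft.
by rewrite [LHS](_ : _ = a *: repr (\pi_cLp f) t)// ft.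
Qed.

Lemma pi_cLpD (f g : cLfunp) : \pi_cLp (f + g) = \pi_cLp f + \pi_cLp g.
Proof. exact: Quotient.pi_add. Qed.

Lemma cLp_scaleA a b x : cLp_scale a (cLp_scale b x) = cLp_scale (a * b) x.
Proof. by rewrite -[x]reprK [cLp_scale b _]pi_cLpZ !pi_cLpZ scalerA. Qed.

Lemma cLp_scale1 : left_id 1 cLp_scale.
Proof. by move=> x; rewrite -[x]reprK pi_cLpZ scale1r. Qed.

Lemma cLp_scaleDr : right_distributive cLp_scale +%R.
Proof.
move=> a x y; rewrite -[x]reprK -[y]reprK -pi_cLpD !pi_cLpZ.
by rewrite -pi_cLpD scalerDr.
Qed.

Lemma cLp_scaleDl x : {morph cLp_scale^~ x : a b / a + b}.
Proof. by move=> a b; rewrite -[x]reprK !pi_cLpZ -pi_cLpD scalerDl. Qed.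

HB.instance Definition _ := GRing.Zmodule_isLmodule.Build R[i] cLp
  cLp_scaleA cLp_scale1 cLp_scaleDr cLp_scaleDl.

Definition cLp_norm (x : cLp) : R[i] := (fine (cLnorm p (repr x)))%:C.

Lemma pi_cLp_norm (f : cLfunp) : cLp_norm (\pi_cLp f) = (fine (cLnorm p f))%:C.
Proof.
have [mf _] := cLfunP f; have [mr _] := cLfunP (repr (\pi_cLp f)).
by rewrite /cLp_norm (cLnorm_ae mr mf (cLp_repr f)).
Qed.

Let cLnorm_fin (f : cLfunp) : cLnorm p f \is a fin_num.
Proof. by have [_ ff] := cLfunP f; rewrite ge0_fin_numE// cLnorm_ge0. Qed.

Lemma cLp_normD x y : cLp_norm (x + y) <= cLp_norm x + cLp_norm y.
Proof.
rewrite -[x]reprK -[y]reprK -pi_cLpD !pi_cLp_norm -rmorphD lecR.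
move: (repr x) (repr y) => f g.
rewrite -fineD ?cLnorm_fin// fine_le ?fin_numD ?cLnorm_fin//.
by apply: cLnormD; [exact: (cLfunP f).1 | exact: (cLfunP g).1].
Qed.

Lemma cLp_normZ a x : cLp_norm (a *: x) = `|a| * cLp_norm x.
Proof.
rewrite -[x]reprK [a *: _]pi_cLpZ !pi_cLp_norm; have [mf ff] := cLfunP (repr x).
rewrite [cLnorm p _](_ : _ = cLnorm p (a *: (repr x : T -> R[i])))//.
by rewrite cLnormZ// fineM ?cLnorm_fin// rmorphM/= rnormK.
Qed.

Lemma cLp_norm0_eq0 x : cLp_norm x = 0 -> x = 0.
Proof.
move=> /complexI/eqP; rewrite fine_eq0 ?cLnorm_fin// => /eqP.
move=> /(cLnorm_eq0 (cLfunP (repr x)).1) x0.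
rewrite -[x]reprK -[RHS]reprK; apply/eqP/cLp_eqP.
have r0 : \forall t \ae mu, repr (0 : cLp) t = 0.
  have -> : 0 = \pi_cLp (0 : cLfunp) by rewrite !piE.
  exact: cLp_repr.
by apply: filterS2 x0 r0 => t -> ->.
Qed.

HB.instance Definition _ := Lmodule_isNormed.Build R[i] cLp
  cLp_normD cLp_normZ cLp_norm0_eq0.

End exponent.
End ComplexLp.
Arguments cLp {d T R} mu {p} p1.

Section Operators.
Context {R : realType} {V : normedModType R[i]}.
Implicit Types A B : V -> V.

Definition opnorm A : \bar R :=
  ereal_sup [set (rnorm (A x))%:E | x in [set x : V | rnorm x <= 1]].

Definition bounded_op A := linear A /\ (opnorm A < +oo)%E.

Definition contraction_op A := linear A /\ (opnorm A <= 1)%E.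

Definition bounded_inverse A B := [/\ bounded_op B, cancel A B & cancel B A].

Definition resolvent_set A : set R[i] :=
  [set l | exists B, bounded_inverse (fun x => l *: x - A x) B].

Definition spectrum A : set R[i] := ~` resolvent_set A.

(* (l - A)^-1; the value is the zero operator when l is in the spectrum of A,
   so statements about it must be accompanied by membership of l in
   resolvent_set A. *)
Definition resolvent A (l : R[i]) : V -> V :=
  xget (fun=> 0) [set B | bounded_inverse (fun x => l *: x - A x) B].

Definition ritt_constant A : \bar R :=
  ereal_sup [set ((rnorm (l - 1))%:E * opnorm (resolvent A l))%E
            | l in [set l : R[i] | 1 < rnorm l]].

Definition ritt_operator A :=
  [/\ bounded_op A, spectrum A `<=` [set l | rnorm l <= 1]
    & (ritt_constant A < +oo)%E].

End Operators.

(* inf is the real infimum, which is 0 on the empty set; the set below is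
   bounded from below by 0 and is nonempty when V != 0 and eps <= 2. *)
Definition modulus_of_convexity (R : realType) (V : normedModType R[i])
    (eps : R) : R :=
  inf [set r | exists x y : V, [/\ rnorm x <= 1, rnorm y <= 1,
    eps <= rnorm (x - y) & r = 1 - rnorm (2^-1 *: (x + y))]].

(* riemannR s is the sequence k |-> 1 / (k.+1)^s *)
Definition zeta_sum {R : realType} (s : R) : R := limn (series (riemannR s)).

Definition ritt_K {R : realType} (s : R) (z : R[i]) : R :=
  2 `^ s^-1 *
  ((pi / (2 * rnorm (z - 1))) `^ s + zeta_sum s / 4 `^ s) `^ s^-1.

(* Main.v *)
Require Import Defs.
From HB Require Import structures.
From mathcomp Require Import all_boot all_order all_algebra.
From mathcomp Require Import all_classical all_reals all_analysis.
From mathcomp Require Import complex.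
From mathcomp Require Import ring lra measurable_realfun.

Set Implicit Arguments.
Unset Strict Implicit.
Unset Printing Implicit Defensive.

Import Order.TTheory GRing.Theory Num.Theory.
Import numFieldNormedType.Exports.

Local Open Scope classical_set_scope.
Local Open Scope ring_scope.

(** The powers of a Ritt contraction on [L^p], via Fourier analysis over the
    n-th roots of a point of the unit circle.

    Fix [z <> 1] on the circle, let [l_0, ..., l_(n-1)] be its n-th roots, and
    put [y = z x - T^n x].  The vectors
    [x_k = z * sum_(i < n) conj(l_k)^i T^i x] satisfy [(l_k - T) x_k = l_k y]
    (a geometric sum telescopes), and orthogonality of the characters gives the
    inversion formula [sum_k l_k^j x_k = n z T^j x] for [0 <= j < n].  The Ritt
    bound survives on the circle away from 1, so [|x_k| <= C |y| / |l_k - 1|].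
    Adding up these norms would cost a factor [log n].  What saves the estimate
    is that [L^p] has Fourier type [s = min(p, p')]: with [s' = max(p, p')],
    [sum_j |sum_k l_k^j x_k|^s' <= n (sum_k |x_k|^s)^(s' - 1)].
    Since [T] is a contraction, each of the [n] terms on the left dominates
    [(n |T^n x|)^s'], whence
    [|T^n x| <= C (sum_k (n |l_k - 1|)^(-s))^(1/s) |y| <= C K_s(z) |y|], and
    [|x| = |z x| <= |y| + |T^n x|] is the claimed lower bound for [z - T^n]
    ([power_lower_bound]).  The same orthogonality writes a preimage under
    [z - T^n] as a combination of preimages under the [l_k - T]
    ([power_surjective]).

    Fourier type follows from the scalar Hausdorff-Young inequality
    ([hausdorff_young]) applied pointwise and from Minkowski's inequality, used
    in one of two directions according to whether [p >= 2].  The scalar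
    inequality, with its sharp constant, is proved by F. Riesz's extremal
    argument: equality in Hoelder's inequality at an extremal vector determines
    the moduli of a dual vector, and Bessel's inequality then bounds the
    constant [B(q)] by [sqrt (L * B(2 q - 2))].  Iterating this moves the
    exponent to infinity and squeezes [B(q)] down to [L]
    ([extremal_equality], [strong_type_step], [strong_type_iter]).

    Passing from the resolvent bound outside the disc to invertibility on the
    circle takes a Neumann series, hence the completeness of [L^p]
    ([cLp_series_converges], [boundary_surjective]).

    Finally, Fourier type for [n = 2] is Clarkson's inequality ([clarkson]), so
    the modulus of convexity is positive.  The bound for [z = -1] says that a
    unit vector [x] and the vector [- T^n x] of the unit ball stay at distance
    at least [1 / (1 + C K(-1))], and the modulus of convexity bounds
    [|x - T^n x|]. *)

(** * Weighted means and finite sums of powers *)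

Section FiniteSums.
Context {R : realType}.
Implicit Types a b u v : R.

(** The equality case is what the extremal argument below rests on.  With
    [m = u^a v^b], the bound is the weighted sum of [1 + ln (u/m) <= u/m] and
    [1 + ln (v/m) <= v/m], which are strict unless [u = m = v]. *)
Lemma weighted_agm u v a b : 0 <= u -> 0 <= v -> 0 < a -> 0 < b -> a + b = 1 ->
  u `^ a * v `^ b <= a * u + b * v
    ?= iff (u == v).
Proof.
move=> u0 v0 a0 b0 ab.
have an0 : a != 0 by rewrite gt_eqF.
have bn0 : b != 0 by rewrite gt_eqF.
have [->|un0] := eqVneq u 0.
  rewrite powR0// mul0r mulr0 add0r; split; first by rewrite mulr_ge0// ltW.
  by rewrite [LHS]eq_sym mulf_eq0 (negbTE bn0)/= eq_sym.
have [->|vn0] := eqVneq v 0.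
  rewrite (powR0 bn0) !mulr0 addr0; split.
    by rewrite mulr_ge0// ltW.
  by rewrite [LHS]eq_sym mulf_eq0 (negbTE an0).
have up : 0 < u by rewrite lt_neqAle eq_sym un0.
have vp : 0 < v by rewrite lt_neqAle eq_sym vn0.
set m := _ * _; have mp : 0 < m by rewrite mulr_gt0// powR_gt0.
have lnm : ln m = a * ln u + b * ln v.
  by rewrite /m lnM ?posrE ?powR_gt0// !ln_powR.
have E w : 0 < w -> w / m = expR (ln w - ln m).
  by move=> wp; rewrite expRB !lnK ?posrE.
have key w : 0 < w -> 1 + (ln w - ln m) <= w / m by move=> wp; rewrite E// expR_ge1Dx.
have keys w : 0 < w -> w != m -> 1 + (ln w - ln m) < w / m.
  move=> wp wm; rewrite E// expR_gt1Dx// subr_eq0.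
  by apply: contra wm => /eqP /ln_inj ->.
have tot : a * (u / m) + b * (v / m) = (a * u + b * v) / m by ring.
have base : a * (1 + (ln u - ln m)) + b * (1 + (ln v - ln m)) = 1.
  by rewrite lnm -[RHS]ab; have -> : b = 1 - a; [rewrite -ab|]; ring.
have le1 : 1 <= (a * u + b * v) / m.
  by rewrite -tot -base lerD// ler_pM2l// key.
split; first by move: le1; rewrite ler_pdivlMr// mul1r.
apply/idP/idP => [/eqP em|/eqP euv]; last first.
  by rewrite /m euv -powRD ?vn0 ?implybT// ab powRr1// -mulrDl ab mul1r.
have um : u == m.
  apply: contraT => /(keys _ up) lu.
  suff: 1 < (a * u + b * v) / m by rewrite -em divff ?ltxx// gt_eqF.
  by rewrite -tot -base ltr_leD// ?ltr_pM2l// ler_pM2l// key.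
have vm : v == m.
  apply: contraT => /(keys _ vp) lv.
  suff: 1 < (a * u + b * v) / m by rewrite -em divff ?ltxx// gt_eqF.
  by rewrite -tot -base ler_ltD// ?ltr_pM2l// ler_pM2l// key.
by rewrite (eqP um) (eqP vm).
Qed.

(** Hoelder's inequality with the exponents moved onto the sums, so that it is
    [weighted_agm] after normalising both families to total mass 1. *)
Lemma hoelder_sum (I : finType) (u v : I -> R) a b :
  (forall i, 0 <= u i) -> (forall i, 0 <= v i) ->
  0 < a -> 0 < b -> a + b = 1 ->
  \sum_i u i `^ a * v i `^ b <= (\sum_i u i) `^ a * (\sum_i v i) `^ b.
Proof.
move=> u0 v0 a0 b0 ab; set U := \sum_i u i; set V := \sum_i v i.
have U0 : 0 <= U by apply: sumr_ge0.
have V0 : 0 <= V by apply: sumr_ge0.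
have [Uz|Un0] := eqVneq U 0.
  rewrite big1 ?mulr_ge0 ?powR_ge0// => i _.
  have /eqP/psumr_eq0P -> // : \sum_i u i == 0 by apply/eqP.
  by rewrite powR0 ?gt_eqF// mul0r.
have [Vz|Vn0] := eqVneq V 0.
  rewrite big1 ?mulr_ge0 ?powR_ge0// => i _.
  have /eqP/psumr_eq0P -> // : \sum_i v i == 0 by apply/eqP.
  by rewrite (powR0 (_ : b != 0)) ?gt_eqF// mulr0.
have UVp : 0 < U `^ a * V `^ b.
  by rewrite mulr_gt0// powR_gt0 // lt_neqAle eq_sym ?Un0 ?Vn0.
have split_ i : u i `^ a * v i `^ b =
    U `^ a * V `^ b * ((u i / U) `^ a * (v i / V) `^ b).
  rewrite mulrACA -!powRM ?divr_ge0//.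
  by rewrite ![_ * (_ / _)]mulrC !divfK.
rewrite (eq_bigr _ (fun i _ => split_ i)) -mulr_sumr ler_piMr//; first exact: ltW.
apply: (@le_trans _ _ (\sum_i (a * (u i / U) + b * (v i / V)))).
  by apply: ler_sum => i _; apply: weighted_agm; rewrite ?divr_ge0.
by rewrite big_split/= -!mulr_sumr -!mulr_suml !divff// !mulr1 ab.
Qed.

End FiniteSums.

(** * Transforms of finite sequences and their adjoints *)

Section FiniteHausdorffYoung.
Context {R : realType}.

Lemma powRVK (x r : R) : 0 <= x -> r != 0 -> (x `^ r) `^ r^-1 = x.
Proof. by move=> x0 r0; rewrite -powRrM divff// powRr1. Qed.

Lemma powRKV (x r : R) : 0 <= x -> r != 0 -> (x `^ r^-1) `^ r = x.
Proof. by move=> x0 r0; rewrite -powRrM mulVf// powRr1. Qed.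

Lemma powRD_gt0 (x r s : R) : 0 < x -> x `^ (r + s) = x `^ r * x `^ s.
Proof. by move=> x0; apply: powRD; rewrite (gt_eqF x0) implybT. Qed.

Lemma ler_powRl (x y r : R) : 0 <= r -> 0 <= x -> x <= y -> x `^ r <= y `^ r.
Proof.
by move=> r0 x0 xy; apply: ge0_ler_powR; rewrite ?nnegrE//; exact: le_trans xy.
Qed.

Lemma hoelder_conj (I : finType) (x y : I -> R) (q : R) : 1 < q ->
  (forall i, 0 <= x i) -> (forall i, 0 <= y i) ->
  \sum_i x i * y i <= (\sum_i x i `^ (q / (q - 1))) `^ ((q - 1) / q) *
                     (\sum_i y i `^ q) `^ q^-1.
Proof.
move=> q1 x0 y0; have q0 : q != 0 by lra.
have q10 : q - 1 != 0 by lra.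
rewrite (eq_bigr (fun i => (x i `^ (q / (q - 1))) `^ ((q - 1) / q) *
   (y i `^ q) `^ q^-1)) => [|i _].
  apply: hoelder_sum => [i|i|||]; rewrite ?powR_ge0// ?invr_gt0 ?divr_gt0//; try lra.
  by rewrite -[X in _ + X]mul1r -mulrDl subrK divff.
by rewrite powRVK// -[X in _ `^ X]invf_div powRVK// mulf_neq0 ?invr_eq0.
Qed.

Lemma rnorm_sum (V : normedZmodType R[i]) (I : finType) (f : I -> V) :
  rnorm (\sum_i f i) <= \sum_i rnorm (f i).
Proof.
elim/big_ind2 : _ => [|x1 x2 y1 y2 h1 h2|//]; first by rewrite rnorm0.
by rewrite (le_trans (ler_rnormD _ _))// lerD.
Qed.

Lemma rnormJ (z : R[i]) : rnorm z^* = rnorm z.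
Proof. by rewrite /rnorm norm_conjC. Qed.

Lemma rnormC (x : R) : 0 <= x -> rnorm (real_complex R x) = x.
Proof. by move=> x0; rewrite /rnorm ger0_norm// ler0c. Qed.

Lemma sqr_rnorm (z : R[i]) : real_complex R (rnorm z ^+ 2) = z * z^*.
Proof. by rewrite rmorphXn/= rnormK normCK. Qed.

Definition transform (J K : finType) (W : J -> K -> R[i]) (a : K -> R[i]) (j : J) :=
  \sum_k W j k * a k.

Definition adjoint (J K : finType) (W : J -> K -> R[i]) (k : K) (j : J) := (W j k)^*.

(** The [r]-th power of an [l^r] norm, so that no outer exponent [1 / r] has to be
    carried along. *)
Definition psum (I : finType) (r : R) (a : I -> R[i]) : R :=
  \sum_i rnorm (a i) `^ r.

(** A bound [l^p -> l^q] for the conjugate exponent [p = q / (q - 1)], raised to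
    the power [q]; note [q / p = q - 1]. *)
Definition strong_type (J K : finType) (W : J -> K -> R[i]) (q B : R) :=
  forall a, psum q (transform W a) <= B * psum (q / (q - 1)) a `^ (q - 1).

(** The duality map [z |z|^(r - 2)], which pairs with [z] to [|z|^r]. *)
Definition spow (r : R) (z : R[i]) : R[i] := z * real_complex R (rnorm z `^ (r - 2)).

Lemma psum_ge0 (I : finType) r (a : I -> R[i]) : 0 <= psum r a.
Proof. by apply: sumr_ge0 => i _; exact: powR_ge0. Qed.

Lemma rnorm_spow r z : 1 < r -> rnorm (spow r z) = rnorm z `^ (r - 1).
Proof.
move=> r1; rewrite rnormM rnormC ?powR_ge0//.
rewrite (_ : r - 2 = (r - 1) - 1); last by ring.
by rewrite mulr_powRB1 ?rnorm_ge0// subr_gt0.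
Qed.

Lemma spow_pairing r z : 1 < r ->
  z^* * spow r z = real_complex R (rnorm z `^ r).
Proof.
move=> r1; rewrite /spow mulrA [z^* * z]mulrC -sqr_rnorm -rmorphM/=; congr (real_complex R _).
rewrite expr2 -mulrA (_ : r - 2 = (r - 1) - 1); last by ring.
rewrite mulr_powRB1 ?rnorm_ge0 ?subr_gt0//.
by rewrite mulr_powRB1 ?rnorm_ge0// (lt_trans _ r1).
Qed.

Section kernel.
Context {J K : finType}.
Variable W : J -> K -> R[i].
Local Notation W' := (adjoint W).

Lemma adjoint_pairing (a : K -> R[i]) (g : J -> R[i]) :
  \sum_k (transform W' g k)^* * a k = \sum_j (g j)^* * transform W a j.
Proof.
transitivity (\sum_k \sum_j (g j)^* * (W j k * a k)).
  apply: eq_bigr => k _; rewrite rmorph_sum mulr_suml; apply: eq_bigr => j _.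
  by rewrite rmorphM/= /adjoint conjCK mulrA [_^* * W _ _]mulrC.
by rewrite exchange_big; apply: eq_bigr => j _; rewrite mulr_sumr.
Qed.

(** A bound [l^p -> l^q] between conjugate exponents is self-dual: test the
    transform against the duality map of the adjoint's output. *)
Lemma strong_type_adjoint q B : 1 < q -> 0 <= B ->
  strong_type W q B -> strong_type W' q B.
Proof.
move=> q1 B0 WB g; set p := q / (q - 1); set G := psum p g.
set h := transform W' g; pose a k := spow q (h k).
set Z := psum q h.
have q0 : q != 0 by lra.
have q10 : q - 1 != 0 by lra.
have G0 : 0 <= G by exact: psum_ge0.
have Z0 : 0 <= Z by exact: psum_ge0.
have Zp : psum p a = Z.
  apply: eq_bigr => k _; rewrite rnorm_spow// -powRrM; congr (_ `^ _).
  by rewrite /p mulrC divfK.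
have ZE : Z%:C%C = \sum_j (g j)^* * transform W a j.
  rewrite -adjoint_pairing rmorph_sum; apply: eq_bigr => k _.
  by rewrite -/h spow_pairing.
have : Z <= \sum_j rnorm (g j) * rnorm (transform W a j).
  rewrite -[leLHS]rnormC// ZE (le_trans (rnorm_sum _))// le_eqVlt; apply/orP; left.
  by apply/eqP; apply: eq_bigr => j _; rewrite rnormM rnormJ.
move/le_trans => /(_ _ (hoelder_conj q1 (fun j => rnorm_ge0 _) (fun j => rnorm_ge0 _))).
rewrite -/(psum _ _) -/p -/G -/(psum _ _) => ZG.
have {}ZG : Z <= G `^ ((q - 1) / q) * (B * Z `^ (q - 1)) `^ q^-1.
  apply: le_trans ZG _; apply: ler_wpM2l; first exact: powR_ge0.
  apply: ler_powRl; [by rewrite invr_ge0; lra|exact: psum_ge0|].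
  by rewrite -Zp; exact: WB.
have [->|Zn0] := eqVneq Z 0; first by rewrite mulr_ge0// powR_ge0.
have Zgt : 0 < Z by rewrite lt_neqAle eq_sym Zn0.
rewrite -(ler_pM2r (powR_gt0 (q - 1) Zgt)) -{1}(powRr1 Z0) -powRD ?Zn0 ?implybT//.
rewrite addrC subrK -[leRHS](@powRKV _ q) ?mulr_ge0 ?powR_ge0//.
apply: ler_powRl => //; first lra.
apply: le_trans ZG _; rewrite le_eqVlt; apply/orP; left; apply/eqP.
rewrite powRM ?powR_ge0// [in RHS]powRM ?mulr_ge0 ?powR_ge0// [in RHS]powRM ?powR_ge0//.
by rewrite -!powRrM mulrA [_ * B `^ _]mulrC.
Qed.

Lemma psum2 (I : finType) (a : I -> R[i]) : psum 2 a = \sum_i rnorm (a i) ^+ 2.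
Proof. by apply: eq_bigr => i _; rewrite powR_mulrn ?rnorm_ge0. Qed.

Section orthogonal.
(* Orthogonal rows of squared length L; for the Fourier matrix, L is its size. *)
Variable L : R.
Hypothesis L0 : 0 < L.
Hypothesis ortho : forall i j,
  \sum_k W i k * (W j k)^* = real_complex R (L *+ (i == j)).

Lemma adjoint_parseval g : psum 2 (transform W' g) = L * psum 2 g.
Proof.
rewrite !psum2; apply: complexI; rewrite rmorphM/= !rmorph_sum/=.
under eq_bigr do rewrite sqr_rnorm mulrC.
rewrite adjoint_pairing mulr_sumr; apply: eq_bigr => j _.
rewrite sqr_rnorm [_ * _^*]mulrC mulrCA; congr (_ * _).
rewrite /transform; under eq_bigr do rewrite mulr_sumr.
rewrite exchange_big/= (bigD1 j)//= [X in _ + X]big1 ?addr0 => [|i ij].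
  by under eq_bigr do rewrite mulrA; rewrite -mulr_suml ortho eqxx mulr1n.
under eq_bigr do rewrite mulrA; rewrite -mulr_suml ortho eq_sym (negbTE ij).
by rewrite mulr0n mul0r.
Qed.

(** The adjoint of [sqrt L] times an isometry, hence bounded by [sqrt L]; this
    is the endpoint [q = 2]. *)
Lemma transform_bessel a : psum 2 (transform W a) <= L * psum 2 a.
Proof.
have Ln0 : L != 0 by rewrite gt_eqF.
set N := psum _ _; have N0 : 0 <= N by exact: psum_ge0.
set h := transform W' (transform W a).
have hN : psum 2 h = L * N by exact: adjoint_parseval.
have NE : real_complex R N = \sum_k (h k)^* * a k.
  rewrite adjoint_pairing /N psum2 rmorph_sum; apply: eq_bigr => j _.
  by rewrite [LHS]sqr_rnorm mulrC.
have : N <= \sum_k rnorm (h k) * rnorm (a k).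
  rewrite -[leLHS]rnormC// NE (le_trans (rnorm_sum _))// le_eqVlt; apply/orP; left.
  by apply/eqP; apply: eq_bigr => j _; rewrite rnormM rnormJ.
have : \sum_k rnorm (h k) * rnorm (a k) <= (2 * L)^-1 * psum 2 h + L / 2 * psum 2 a.
  rewrite !psum2 !mulr_sumr -big_split; apply: ler_sum => k _ /=.
  have L20 : 0 < 2 * L by rewrite mulr_gt0.
  rewrite -subr_ge0 (_ : _ - _ = (2 * L)^-1 * (rnorm (h k) - L * rnorm (a k)) ^+ 2).
    by rewrite mulr_ge0 ?sqr_ge0// invr_ge0 ltW.
  by field.
rewrite hN (_ : _^-1 * _ = N / 2); last by field.
lra.
Qed.

End orthogonal.
End kernel.

(** The [l^r] norms are logarithmically convex in [1 / r].  The conjugate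
    exponent of [2 q - 2] lies between [2 / (q - 1)] and [q / (q - 1)], and the
    weights are such that the first sum appears to the power 1. *)
Lemma interpolate_sum (I : finType) (x : I -> R) (q : R) : 2 < q ->
  (forall i, 0 <= x i) ->
  (\sum_i x i `^ ((2 * q - 2) / (2 * q - 3))) `^ (2 * q - 3) <=
  (\sum_i x i `^ (2 / (q - 1))) * (\sum_i x i `^ (q / (q - 1))) `^ (2 * q - 4).
Proof.
move=> q2 x0; set a := (2 * q - 3)^-1; set b := (2 * q - 4) / (2 * q - 3).
have q1 : q - 1 != 0 by lra.
have q3 : 2 * q - 3 != 0 by lra.
have ab : a + b = 1.
  by apply: (mulIf q3); rewrite mulrDl mulVf// divfK//; ring.
have q30 : 0 <= 2 * q - 3 by lra.
have a0 : 0 < a by rewrite invr_gt0; lra.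
have b0 : 0 < b by rewrite divr_gt0; lra.
have -> : \sum_i x i `^ ((2 * q - 2) / (2 * q - 3)) =
    \sum_i (x i `^ (2 / (q - 1))) `^ a * (x i `^ (q / (q - 1))) `^ b.
  apply: eq_bigr => i _; rewrite -!powRrM -powRD.
    by congr (_ `^ _); rewrite /a /b; field; rewrite q1 q3.
  apply/implyP => /eqP e; exfalso.
  have : 0 < 2 / (q - 1) * a + q / (q - 1) * b.
    by rewrite addr_gt0// mulr_gt0// divr_gt0; lra.
  by rewrite e ltxx.
have := hoelder_sum (fun i => powR_ge0 (x i) (2 / (q - 1)))
  (fun i => powR_ge0 (x i) (q / (q - 1))) a0 b0 ab.
set X := \sum_i _ `^ _; set Y := \sum_i _ `^ _; set Z := \sum_i _ => XY.
have Y0 : 0 <= Y by apply: sumr_ge0 => i _; exact: powR_ge0.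
have X0 : 0 <= X by apply: sumr_ge0 => i _; exact: powR_ge0.
have Z0 : 0 <= Z by apply: sumr_ge0 => i _; rewrite mulr_ge0// powR_ge0.
clearbody X Y Z; apply: le_trans (ler_powRl q30 Z0 XY) _.
rewrite (powRM _ (powR_ge0 _ _) (powR_ge0 _ _)) /a (powRKV X0 q3).
by rewrite -powRrM /b divfK.
Qed.
End FiniteHausdorffYoung.

(** * Existence of an extremal vector *)

Section Extremal.
Context {R : realType}.

(** The absolute value is there because [powR] is not continuous at 0 from the
    left. *)
Lemma continuous_powR_norm (r : R) : 0 < r -> continuous (fun x : R => `|x| `^ r).
Proof.
move=> r0 x; have [->|xn0] := eqVneq x 0.
  apply/cvgrPdist_lt => e e0; near=> y.
  rewrite normr0 powR0 ?gt_eqF// sub0r normrN ger0_norm ?powR_ge0//.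
  rewrite -[ltRHS](powRKV (ltW e0) (lt0r_neq0 r0)).
  apply: gt0_ltr_powR; rewrite ?nnegrE ?powR_ge0//.
  near: y; have := @cvgr0_norm_lt R R _ _ _ id (@cvg_id _ _ ).
  by apply; rewrite powR_gt0.
have x0 : 0 < `|x| by rewrite normr_gt0.
apply: (@continuous_comp _ _ _ (@Num.norm R R) (@powR R ^~ r)).
  exact: norm_continuous.
apply: differentiable_continuous; apply/derivable1_diffP.
by apply: derivable_powR; rewrite in_itv/= x0.
Unshelve. all: by end_near. Qed.

Lemma continuous_fin_sum (T : topologicalType) (I : finType) (f : I -> T -> R) :
  (forall i, continuous (f i)) -> continuous (fun x => \sum_i f i x).
Proof.
move=> cf; elim: (index_enum I) => [|i r IHr] x.
  by under eq_fun do rewrite big_nil; exact: cvg_cst.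
by under eq_fun do rewrite big_cons; exact: cvgD (cf i x) (IHr x).
Qed.

Section vec.
Context {J : finType} {n : nat} (W : J -> 'I_n -> R[i]).

Definition cvec (x : 'rV[R]_(n + n)) (k : 'I_n) : R[i] :=
  Complex (x 0 (lshift n k)) (x 0 (rshift n k)).

Lemma continuous_psum (I : finType) (F : 'rV[R]_(n + n) -> I -> R[i]) (r : R) :
  0 < r ->
  (forall i, continuous (fun x => complex.Re (F x i))) ->
  (forall i, continuous (fun x => complex.Im (F x i))) ->
  continuous (fun x => psum r (F x)).
Proof.
move=> r0 cR cI; apply: continuous_fin_sum => i.
rewrite (_ : (fun y => _) = (fun u : R => `|u| `^ (r / 2)) \o
  (fun y => complex.Re (F y i) * complex.Re (F y i) +
            complex.Im (F y i) * complex.Im (F y i))); last first.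
  apply/funext => y /=; rewrite rnormE -!expr2 ger0_norm ?addr_ge0 ?sqr_ge0//.
  by rewrite -powR12_sqrt ?addr_ge0 ?sqr_ge0// -powRrM mulrC.
move=> x; apply: continuous_comp; last by apply: continuous_powR_norm; rewrite divr_gt0.
exact: cvgD (cvgM (cR i x) (cR i x)) (cvgM (cI i x) (cI i x)).
Qed.

Lemma continuous_coord i : continuous (fun x : 'rV[R]_(n + n) => x 0 i).
Proof. exact: coord_continuous. Qed.

Lemma continuous_coordM c i : continuous (fun x : 'rV[R]_(n + n) => c * x 0 i).
Proof. move=> x; exact: cvgM (@cvg_cst R c _ (nbhs x) _) (@continuous_coord i x). Qed.

Lemma continuous_psum_cvec r : 0 < r -> continuous (fun x => psum r (cvec x)).
Proof. by move=> r0; apply: continuous_psum => // i; exact: continuous_coord. Qed.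

Lemma Re_sum (I : finType) (f : I -> R[i]) :
  complex.Re (\sum_i f i) = \sum_i complex.Re (f i).
Proof. by elim/big_rec2 : _ => // i ? [? ?] _ <-; case: (f i). Qed.

Lemma Im_sum (I : finType) (f : I -> R[i]) :
  complex.Im (\sum_i f i) = \sum_i complex.Im (f i).
Proof. by elim/big_rec2 : _ => // i ? [? ?] _ <-; case: (f i). Qed.

Lemma continuous_psum_transform r : 0 < r ->
  continuous (fun x => psum r (transform W (cvec x))).
Proof.
move=> r0; apply: continuous_psum => // j.
  under eq_fun do rewrite Re_sum; apply: continuous_fin_sum => k x.
  case: (W j k) => a b /=.
  exact: cvgB (@continuous_coordM a _ x) (@continuous_coordM b _ x).
under eq_fun do rewrite Im_sum; apply: continuous_fin_sum => k x.
case: (W j k) => a b /=.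
exact: cvgD (@continuous_coordM a _ x) (@continuous_coordM b _ x).
Qed.

Lemma ReIm_le_rnorm (z : R[i]) : `|complex.Re z| <= rnorm z /\ `|complex.Im z| <= rnorm z.
Proof.
rewrite rnormE; split; rewrite -sqrtr_sqr ler_wsqrtr//.
  by rewrite lerDl sqr_ge0.
by rewrite lerDr sqr_ge0.
Qed.

Lemma rnorm_le_psum (I : finType) (a : I -> R[i]) r i : 0 < r ->
  psum r a = 1 -> rnorm (a i) <= 1.
Proof.
move=> r0 a1; have : rnorm (a i) `^ r <= 1.
  rewrite -a1 /psum (bigD1 i)//= lerDl sumr_ge0// => *; exact: powR_ge0.
move=> ai1; have <- : (1 : R) `^ r^-1 = 1 by rewrite powR1.
rewrite -[leLHS](powRVK (rnorm_ge0 (a i)) (lt0r_neq0 r0)).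
by apply: ler_powRl; [rewrite invr_ge0 ltW|exact: powR_ge0|].
Qed.

(** The unit sphere of [l^p] is compact in [R^(2n)], so the transform attains
    its norm; homogeneity extends the maximum to all vectors. *)
Lemma exists_extremal q : 1 < q -> (0 < n)%N ->
  exists a, psum (q / (q - 1)) a = 1 /\ strong_type W q (psum q (transform W a)).
Proof.
move=> q1 n0; set p := q / (q - 1).
have p0 : 0 < p by rewrite divr_gt0; lra.
have q0 : 0 < q by lra.
pose A := (fun x : 'rV[R]_(n + n) => psum p (cvec x)) @^-1` [set 1].
have cA : compact A.
  apply: bounded_closed_compact.
    exists 1; split => // M M1 x Ax; apply: le_trans (ltW M1).
    rewrite [leLHS]/Num.norm/= mx_normrE; apply/bigmax_leP; split => // -[i j] _ /=.
    rewrite (ord1 i); have [k ->|k ->] := split_ordP j.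
      have [h _] := ReIm_le_rnorm (cvec x k).
      by apply: le_trans h _; exact: rnorm_le_psum Ax.
    have [_ h] := ReIm_le_rnorm (cvec x k).
    by apply: le_trans h _; exact: rnorm_le_psum Ax.
  have /continuous_closedP h := continuous_psum_cvec p0.
  by apply: h; exact: closed_eq.
have A0 : A !=set0.
  exists (\row_i (i == lshift n (Ordinal n0))%:R); rewrite /A/= /psum (bigD1 (Ordinal n0))//=.
  rewrite big1 => [|k k0].
    by rewrite rnormE/= !mxE eqxx eq_rlshift expr1n expr0n !addr0 sqrtr1 powR1.
  rewrite rnormE/= !mxE eq_rlshift (inj_eq (@lshift_inj _ _)) (negbTE k0).
  by rewrite !expr0n addr0 sqrtr0 powR0// gt_eqF.
have [x /set_mem Ax xmax] := EVT_max_rV A0 cA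
  (continuous_subspaceT (continuous_psum_transform q0)).
exists (cvec x); split=> // b; set P := psum p b.
have P0 : 0 <= P by exact: psum_ge0.
have q10 : q - 1 != 0 by lra.
have [Pz|Pn0] := eqVneq P 0.
  have bz k : b k = 0.
    have /psumr_eq0P : P = 0 by [].
    move=> /(_ (fun i _ => powR_ge0 _ _)) /(_ k isT) /powR_eq0_eq0.
    exact: rnorm0_eq0.
  rewrite /psum big1 ?mulr_ge0 ?sumr_ge0// => [*|*|j _]; rewrite ?powR_ge0//.
  rewrite /transform big1; first by rewrite rnorm0 powR0// gt_eqF.
  by move=> k _; rewrite bz mulr0.
have Pp : 0 < P by rewrite lt_neqAle eq_sym Pn0.
pose t := P `^ p^-1; have tp : 0 < t by exact: powR_gt0.
pose y : 'rV[R]_(n + n) := \row_(i < n + n) match fintype.split i with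
  | inl k => t^-1 * complex.Re (b k) | inr k => t^-1 * complex.Im (b k) end.
have yE k : cvec y k = real_complex R t^-1 * b k.
  rewrite /cvec !mxE (unsplitK (inl k)) (unsplitK (inr k)).
  by case: (b k) => u v; congr Complex; rewrite /= mul0r ?addr0 ?subr0.
have ty0 : 0 <= t^-1 by rewrite invr_ge0 ltW.
have scale (I : finType) r (f : I -> R[i]) g :
    (forall i, f i = real_complex R t^-1 * g i) -> psum r f = t^-1 `^ r * psum r g.
  move=> fg; rewrite mulr_sumr; apply: eq_bigr => i _.
  by rewrite fg rnormM rnormC// powRM// rnorm_ge0.
have Ay : A y.
  rewrite /A/= (scale _ _ _ _ yE) -/P /t -powRN -powRrM.
  by rewrite mulNr mulVf ?gt_eqF// powRN powRr1// mulVf.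
have := xmax y (mem_set Ay).
rewrite (scale _ _ _ (transform W b)); last first.
  move=> j; rewrite /transform mulr_sumr; apply: eq_bigr => k _.
  by rewrite yE mulrCA.
rewrite /t -powRN -powRrM mulNr (_ : p^-1 * q = q - 1).
  by rewrite powRN mulrC ler_pdivrMr ?powR_gt0.
by rewrite /p invf_div divfK// gt_eqF.
Qed.

End vec.
End Extremal.

(** * The finite Hausdorff-Young inequality *)

Section Iteration.
Context {R : realType}.

Lemma spow_pairingr (r : R) z : 1 < r ->
  (spow r z)^* * z = real_complex R (rnorm z `^ r).
Proof.
move=> r1; rewrite -[LHS]conjCK rmorphM/= conjCK mulrC spow_pairing//.
by apply: conj_Creal; apply/complex_realP; eexists.
Qed.

Lemma psum_spow (I : finType) (a : I -> R[i]) (q r : R) : 1 < q ->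
  psum r (fun i => spow q (a i)) = psum ((q - 1) * r) a.
Proof. by move=> q1; apply: eq_bigr => i _; rewrite rnorm_spow// powRrM. Qed.

Section step.
Context {J : finType} {n : nat} (W : J -> 'I_n -> R[i]) (L : R).
Hypothesis L0 : 0 < L.
Hypothesis ortho : forall i j,
  \sum_k W i k * (W j k)^* = real_complex R (L *+ (i == j)).

Lemma strong_type_le q B B' : B <= B' -> strong_type W q B -> strong_type W q B'.
Proof. by move=> BB' WB a; apply: le_trans (WB a) _; rewrite ler_wpM2r ?powR_ge0. Qed.

(** At a maximiser [a], the dual vector [h] of [W a] satisfies
    [S <= sum |h_k| |a_k|] by duality and [sum |h_k|^q <= S^q] by
    [strong_type_adjoint].  Hoelder's inequality is therefore an equality, which
    ties [|h_k|] to a power of [|a_k|]. *)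
Lemma extremal_equality (q : R) (a : 'I_n -> R[i]) : 1 < q ->
  psum (q / (q - 1)) a = 1 -> strong_type W q (psum q (transform W a)) ->
  forall k, rnorm (transform (adjoint W) (fun j => spow q (transform W a j)) k) =
            psum q (transform W a) * rnorm (a k) `^ (q - 1)^-1.
Proof.
move=> q1; set p := q / (q - 1); set b := transform W a; set S := psum q b.
set h := transform _ _ => a1 WS.
have q0 : q != 0 by lra.
have q10 : q - 1 != 0 by lra.
have S0 : 0 <= S by exact: psum_ge0.
have hS : psum q h <= S `^ q.
  have := strong_type_adjoint q1 S0 WS (fun j => spow q (b j)).
  rewrite psum_spow// (_ : (q - 1) * _ = q); last by rewrite mulrC divfK.
  by rewrite -/S mulr_powRB1//; lra.
have Sha : S <= \sum_k rnorm (h k) * rnorm (a k).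
  have SE : real_complex R S = \sum_k (h k)^* * a k.
    rewrite adjoint_pairing /S rmorph_sum; apply: eq_bigr => j _.
    by rewrite spow_pairingr.
  rewrite -[leLHS]rnormC// SE (le_trans (rnorm_sum _))// le_eqVlt; apply/orP; left.
  by apply/eqP; apply: eq_bigr => j _; rewrite rnormM rnormJ.
have [Sz k|Sn0] := eqVneq S 0.
  rewrite Sz mul0r; apply: (@powR_eq0_eq0 _ _ q).
  have : psum q h <= 0 by rewrite (le_trans hS)// Sz powR0.
  rewrite le_eqVlt ltNge psum_ge0 orbF => /eqP /psumr_eq0P; apply => // i _.
  exact: powR_ge0.
have Sp : 0 < S by rewrite lt_neqAle eq_sym Sn0.
pose u k := rnorm (a k) `^ p; pose v k := rnorm (h k) `^ q / S `^ q.
have u0 k : 0 <= u k by exact: powR_ge0.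
have v0 k : 0 <= v k by rewrite divr_ge0 ?powR_ge0.
have pn0 : p != 0 by rewrite mulf_neq0 ?invr_eq0.
have al0 : 0 < (q - 1) / q by rewrite divr_gt0; lra.
have be0 : 0 < q^-1 by rewrite invr_gt0; lra.
have ab : (q - 1) / q + q^-1 = 1 by field.
have uv k : u k `^ ((q - 1) / q) * v k `^ q^-1 = rnorm (h k) * rnorm (a k) / S.
  rewrite /u /v powRM ?powR_ge0 ?invr_ge0 ?powR_ge0//.
  rewrite -[X in _ `^ X]invf_div powRVK ?rnorm_ge0//.
  rewrite powRVK ?rnorm_ge0// -powRN -powRrM mulNr divff// powR_inv1//.
  by rewrite mulrA [rnorm (a k) * _]mulrC.
have v1 : \sum_k v k <= 1 by rewrite -mulr_suml ler_pdivrMr ?powR_gt0// mul1r.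
have agm k := weighted_agm (u0 k) (v0 k) al0 be0 ab.
(* Each defect in the weighted mean inequality is nonnegative, and their sum is
   at most 0. *)
have gap : \sum_k ((q - 1) / q * u k + q^-1 * v k - u k `^ ((q - 1) / q) * v k `^ q^-1) = 0.
  apply/eqP; rewrite eq_le; apply/andP; split; last first.
    by apply: sumr_ge0 => k _; rewrite subr_ge0; exact: agm.
  rewrite sumrB subr_le0 (eq_bigr _ (fun k _ => uv k)) -mulr_suml.
  apply: (@le_trans _ _ 1); last by rewrite ler_pdivlMr// mul1r.
  rewrite big_split/= -!mulr_sumr -/(psum _ _) a1 mulr1 -[leRHS]ab lerD2l.
  by rewrite -[leRHS]mulr1 ler_wpM2l// ltW.
have gap0 k : xpredT k -> 0 <= (q - 1) / q * u k + q^-1 * v k -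
    u k `^ ((q - 1) / q) * v k `^ q^-1.
  by move=> _; rewrite subr_ge0; exact: agm.
move=> k; have : u k = v k.
  apply/eqP; rewrite -(agm k).2 -subr_eq0 -oppr_eq0 opprB.
  by rewrite (psumr_eq0P gap0 gap).
rewrite /u /v => /(congr1 (fun x => (x * S `^ q) `^ q^-1)).
rewrite divfK; last by rewrite gt_eqF// powR_gt0.
rewrite powRVK ?rnorm_ge0// powRM ?powR_ge0// powRVK// -powRrM => <-.
by rewrite mulrC; congr (_ * _ `^ _); rewrite /p; field; rewrite q0 q10.
Qed.

(** Bessel's inequality for the dual vector [h] of an extremal [a] reads
    [S^2 sum |a_k|^(2/(q-1)) <= L sum |(W a)_j|^(2q-2)].  The right-hand side is
    controlled by the bound for the exponent [2 q - 2], and after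
    [interpolate_sum] the sum on the left cancels. *)
Lemma strong_type_step q B : 2 < q -> 0 <= B ->
  strong_type W (2 * q - 2) B -> strong_type W q (Num.sqrt (L * B)).
Proof.
move=> q2 B0 WB; have q1 : 1 < q by lra.
have q0 : q != 0 by lra.
have q10 : q - 1 != 0 by lra.
have [n0|n0] := posnP n.
  move=> a; rewrite /psum big1 ?mulr_ge0 ?sqrtr_ge0 ?powR_ge0// => j _.
  rewrite /transform big1 ?rnorm0 ?powR0// => k.
  by have := leq_ltn_trans (leq0n k) (ltn_ord k); rewrite [X in (_ < X)%N]n0.
have [a [a1 WS]] := exists_extremal W q1 n0.
apply: (strong_type_le _ WS).
have S0 := psum_ge0 q (transform W a).
rewrite -(ger0_norm S0) -sqrtr_sqr ler_wsqrtr//.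
have := extremal_equality q1 a1 WS.
set b := transform W a; set h := transform _ _; set S := psum q b => hE.
pose X := \sum_k rnorm (a k) `^ (2 / (q - 1)).
have X0 : 0 < X.
  rewrite lt_neqAle sumr_ge0 ?andbT => [|k _]; last exact: powR_ge0.
  apply/negP => /eqP/esym/psumr_eq0P => h0.
  move: a1; rewrite /psum big1 => [/esym/eqP|k _]; first by rewrite oner_eq0.
  rewrite (powR_eq0_eq0 (h0 _ k _))// => *; last exact: powR_ge0.
  by rewrite powR0// mulf_neq0 ?invr_eq0.
rewrite -(ler_pM2r X0).
have -> : S ^+ 2 * X = psum 2 h.
  rewrite mulr_sumr; apply: eq_bigr => k _.
  rewrite hE powRM ?powR_ge0// powR_mulrn// -powRrM.
  by rewrite [_^-1 * 2]mulrC.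
rewrite (adjoint_parseval ortho) -mulrA ler_pM2l// psum_spow//.
rewrite (_ : (q - 1) * 2 = 2 * q - 2); last by ring.
apply: le_trans (WB a) _; rewrite ler_wpM2l//.
have -> : 2 * q - 2 - 1 = 2 * q - 3 by ring.
apply: le_trans (interpolate_sum q2 (fun k => rnorm_ge0 (a k))) _.
have a1' : \sum_k rnorm (a k) `^ (q / (q - 1)) = 1 by exact: a1.
by rewrite a1' powR1 mulr1.
Qed.

Hypothesis W1 : forall j k, rnorm (W j k) <= 1.

(** Any bound that does not grow with [q] would do: only its [2^m]-th root
    survives in [strong_type_iter]. *)
Lemma strong_type_crude q : 1 < q -> strong_type W q (#|J|%:R * n%:R).
Proof.
move=> q1 a; have q0 : q != 0 by lra.
have q10 : q - 1 != 0 by lra.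
set P := psum (q / (q - 1)) a; have P0 : 0 <= P by exact: psum_ge0.
have sum1 : \sum_k rnorm (a k) <= P `^ ((q - 1) / q) * n%:R `^ q^-1.
  have := hoelder_conj q1 (fun k => rnorm_ge0 (a k)) (fun k : 'I_n => ler01).
  under eq_bigr do rewrite mulr1.
  by rewrite powR1 sumr_const card_ord.
have Wa j : rnorm (transform W a j) `^ q <= n%:R * P `^ (q - 1).
  have Wa : rnorm (transform W a j) <= P `^ ((q - 1) / q) * n%:R `^ q^-1.
    apply: le_trans (rnorm_sum _) _; apply: le_trans _ sum1.
    by apply: ler_sum => k _; rewrite rnormM ler_piMl ?rnorm_ge0.
  have q0' : 0 <= q by lra.
  apply: le_trans (ler_powRl q0' (rnorm_ge0 _) Wa) _.
  rewrite (powRM _ (powR_ge0 _ _) (powR_ge0 _ _)) (powRKV (ler0n _ _) q0).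
  by rewrite -powRrM divfK// mulrC.
rewrite -mulrA; apply: le_trans (ler_sum _ (fun j _ => Wa j)) _.
by rewrite sumr_const [leRHS]mulr_natl.
Qed.

(** [m] applications of the step start from the exponent [2 + 2^m (q - 2)], and
    each takes the geometric mean with [L]. *)
Lemma strong_type_iter m q : 2 < q ->
  strong_type W q (L * (1 + #|J|%:R * n%:R / L) `^ (2 ^- m)).
Proof.
(* The summand 1 keeps the base positive even when an index type is empty. *)
set D := 1 + _; have D1 : 1 <= D by rewrite lerDl divr_ge0// ?mulr_ge0// ltW.
have D0 : 0 <= D by rewrite (le_trans _ D1).
elim: m q => [|m IH] q q2.
  apply: strong_type_le (strong_type_crude _); last lra.
  rewrite expr0 invr1 powRr1// mulrDr mulr1 [L * _]mulrC divfK ?gt_eqF//.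
  by rewrite lerDr ltW.
have := strong_type_step q2 _ (IH (2 * q - 2) _).
rewrite mulrA -expr2 sqrtrM ?sqr_ge0// sqrtr_sqr gtr0_norm//.
rewrite -powR12_sqrt ?powR_ge0// -powRrM -invfM -exprSr; apply.
  by rewrite mulr_ge0 ?powR_ge0// ltW.
lra.
Qed.

(** F. Riesz's theorem for bounded orthogonal systems: the constants of
    [strong_type_iter] tend to [L], and [q = 2] is Bessel's inequality. *)
Lemma hausdorff_young q : 2 <= q -> strong_type W q L.
Proof.
rewrite le_eqVlt => /predU1P[<-|q2] a.
  have -> : 2 - 1 = 1 :> R by ring.
  by rewrite divr1 powRr1 ?psum_ge0//; exact: transform_bessel.
set D := 1 + #|J|%:R * n%:R / L.
have D0 : 0 < D by rewrite ltr_wpDr// divr_ge0// ?mulr_ge0// ltW.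
have cv : (L * D `^ (2 ^- m)) * psum (q / (q - 1)) a `^ (q - 1) @[m --> \oo] -->
    (L * 1) * psum (q / (q - 1)) a `^ (q - 1).
  apply: cvgMr_tmp; apply: cvgMl_tmp.
  have -> : (fun m => D `^ (2 ^- m)) = (fun m => expR (2 ^- m * ln D)) :> (nat -> R).
    by apply/funext => m; rewrite /powR gt_eqF.
  suff h : (fun m => expR (2 ^- m * ln D)) @ \oo --> expR (0 * ln D).
    by rewrite mul0r expR0 in h.
  apply: continuous_cvg; first exact: continuous_expR.
  apply: cvgMr_tmp; under eq_fun do rewrite -exprVn.
  by apply: cvg_expr; rewrite gtr0_norm ?invr_gt0 ?ltr0n// invf_lt1 ?ltr0n ?ltr1n.
rewrite -[L]mulr1 -(cvg_lim _ cv)//; apply: limr_ge; first by apply/cvg_ex; eexists; exact: cv.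
by apply: nearW => m; exact: strong_type_iter.
Qed.

End step.
End Iteration.

(** * Minkowski inequalities for integrals *)

Section Minkowski.
Context {d} {T : measurableType d} {R : realType} (mu : {measure set T -> \bar R}).

Lemma integral_lincomb (I : finType) (c : I -> R) (f : I -> T -> R) (a : I -> R) :
  (forall i, 0 <= c i) -> (forall i t, 0 <= f i t) ->
  (forall i, measurable_fun setT (f i)) ->
  (forall i, (\int[mu]_t (f i t)%:E = (a i)%:E)%E) ->
  (\int[mu]_t (\sum_i c i * f i t)%:E = (\sum_i c i * a i)%:E)%E.
Proof.
move=> c0 f0 mf fa; under eq_integral do rewrite -sumEFin.
rewrite ge0_integral_sum//=; last 2 first.
- by move=> i; apply/measurable_EFinP; exact: measurable_funM.
- by move=> i t _; rewrite lee_fin mulr_ge0.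
rewrite -sumEFin; apply: eq_bigr => i _.
under eq_integral do rewrite EFinM.
rewrite ge0_integralZl//; first by rewrite fa.
- exact/measurable_EFinP.
- by move=> t _; rewrite lee_fin.
- by rewrite lee_fin.
Qed.

(** Minkowski's inequality [ |int u|_r <= int |u|_r ] for vector-valued [u],
    combined with a pointwise bound: with [S = sum_j A_j^r], integrate
    [sum_j A_j^(r-1) u_j <= S^(1-1/r) (sum_j u_j^r)^(1/r)]. *)
Lemma minkowski_power_integral (J : finType) (u : J -> T -> R) (v : T -> R) (A : J -> R) (V L r : R) :
  1 < r -> 0 <= L ->
  (forall j t, 0 <= u j t) -> (forall j, measurable_fun setT (u j)) ->
  (forall t, 0 <= v t) -> measurable_fun setT v ->
  (forall j, (\int[mu]_t (u j t)%:E = (A j)%:E)%E) -> (\int[mu]_t (v t)%:E = V%:E)%E ->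
  (forall t, \sum_j u j t `^ r <= L * v t `^ r) ->
  \sum_j A j `^ r <= L * V `^ r.
Proof.
move=> r1 L0 u0 mu_ v0 mv uA vV uv.
have r0 : r != 0 by lra.
have r10 : r - 1 != 0 by lra.
have A0 j : 0 <= A j by rewrite -lee_fin -uA integral_ge0// => t _; rewrite lee_fin.
have V0 : 0 <= V by rewrite -lee_fin -vV integral_ge0// => t _; rewrite lee_fin.
set S := \sum_j A j `^ r; have S0 : 0 <= S by apply: sumr_ge0 => *; exact: powR_ge0.
pose w j := A j `^ (r - 1).
have w0 j : 0 <= w j by exact: powR_ge0.
pose c := S `^ ((r - 1) / r) * L `^ r^-1.
have c0 : 0 <= c by rewrite mulr_ge0 ?powR_ge0.
have pt t : \sum_j w j * u j t <= c * v t.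
  apply: le_trans (hoelder_conj r1 w0 (fun j => u0 j t)) _.
  have -> : \sum_j w j `^ (r / (r - 1)) = S.
    by apply: eq_bigr => j _; rewrite /w -powRrM mulrC divfK.
  rewrite /c -mulrA ler_wpM2l ?powR_ge0//.
  have h : v t = (v t `^ r) `^ r^-1 by rewrite powRVK.
  rewrite [in leRHS]h -powRM ?powR_ge0//.
  apply: ler_powRl => //; first by rewrite invr_ge0; lra.
  by apply: sumr_ge0 => j _; exact: powR_ge0.
have : S <= c * V.
  have -> : S = \sum_j w j * A j.
    by apply: eq_bigr => j _; rewrite /w mulrC mulr_powRB1//; lra.
  rewrite -lee_fin -(integral_lincomb w0 u0 mu_ uA).
  have -> : (c * V)%:E = (\int[mu]_t (c * v t)%:E)%E.
    under eq_integral do rewrite EFinM.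
    rewrite ge0_integralZl//; first by rewrite vV EFinM.
    - exact/measurable_EFinP.
    - by move=> t _; rewrite lee_fin.
  apply: ge0_le_integral => //.
  - by move=> t _; rewrite lee_fin sumr_ge0// => j _; rewrite mulr_ge0.
  - by apply/measurable_EFinP; apply: measurable_sum => j; exact: measurable_funM.
  - by apply/measurable_EFinP; exact: measurable_funM.
  - by move=> t _; rewrite lee_fin.
rewrite /c -mulrA => SV.
have [->|Sn0] := eqVneq S 0; first by rewrite mulr_ge0 ?powR_ge0.
have Sp : 0 < S by rewrite lt_neqAle eq_sym Sn0.
have Sr : 0 < S `^ ((r - 1) / r) by exact: powR_gt0.
have {}SV : S `^ r^-1 <= L `^ r^-1 * V.
  rewrite -(ler_pM2l Sr) (le_trans _ SV)// -powRD_gt0//.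
  by rewrite -[X in _ + X]mul1r -mulrDl subrK divff// powRr1.
have r0' : 0 <= r by lra.
have := ler_powRl r0' (powR_ge0 _ _) SV.
by rewrite powRM ?powR_ge0// !powRKV.
Qed.

(** Jensen's inequality for the weights [w], i.e. convexity of [x^r] along
    [sum_i (w_i / sum w) (v_i / w_i)]. *)
Lemma weighted_power_mean (I : finType) (w v : I -> R) (r : R) : 1 <= r ->
  (forall i, 0 < w i) -> (forall i, 0 <= v i) ->
  (\sum_i v i) `^ r <= (\sum_i w i) `^ (r - 1) * \sum_i w i `^ (1 - r) * v i `^ r.
Proof.
rewrite le_eqVlt => /predU1P[<- w0 v0|r1 w0 v0].
  rewrite !subrr powRr0 mul1r powRr1 ?sumr_ge0//.
  by apply: ler_sum => i _; rewrite powRr0 mul1r powRr1.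
have r0 : r != 0 by lra.
have W0 : 0 <= \sum_i w i by apply: sumr_ge0 => i _; exact: ltW.
pose a := (r - 1) / r; pose b := r^-1.
have a0 : 0 < a by rewrite divr_gt0; lra.
have b0 : 0 < b by rewrite invr_gt0; lra.
have ab : a + b = 1 by rewrite /a /b; field.
have z0 i : 0 <= w i `^ (1 - r) * v i `^ r by rewrite mulr_ge0 ?powR_ge0.
have := hoelder_sum (fun i => ltW (w0 i)) z0 a0 b0 ab.
under eq_bigr => i _.
  rewrite powRM ?powR_ge0// powRVK// -powRrM mulrA -powRD_gt0//.
  rewrite (_ : _ + _ = 0); first by rewrite powRr0 mul1r; over.
  by rewrite /a /b; field.
have r0' : 0 <= r by lra.
have Y0 : 0 <= \sum_i w i `^ (1 - r) * v i `^ r by apply: sumr_ge0 => i _; exact: z0.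
have X0 : 0 <= \sum_i v i by exact: sumr_ge0.
move: W0 Y0 X0; move: (\sum_i w i) (\sum_i _ * _) (\sum_i v i) => W Y X W0 Y0 X0 XWY.
apply: le_trans (ler_powRl r0' X0 XWY) _.
by rewrite (powRM _ (powR_ge0 _ _) (powR_ge0 _ _)) (powRKV Y0 r0) -powRrM divfK.
Qed.

(** The optimal weights in [weighted_power_mean] are the norms [B i]; they may
    vanish, so they are shifted by a small [e]. *)
Lemma minkowski_sum (I : finType) (v : I -> T -> R) (B : I -> R) (r : R) : 1 <= r ->
  (forall i t, 0 <= v i t) -> (forall i, measurable_fun setT (v i)) ->
  (forall i, 0 <= B i) ->
  (forall i, (\int[mu]_t (v i t `^ r)%:E = (B i `^ r)%:E)%E) ->
  (\int[mu]_t ((\sum_i v i t) `^ r)%:E <= ((\sum_i B i) `^ r)%:E)%E.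
Proof.
move=> r1 v0 mv B0 vB; set S := \sum_i B i.
have S0 : 0 <= S by exact: sumr_ge0.
have r0' : 0 <= r by lra.
have r0 : r != 0 by lra.
have mvr i : measurable_fun setT (fun t => v i t `^ r).
  exact: (@measurableT_comp _ _ _ _ _ _ (@powR R ^~ r)).
have eps e : 0 < e ->
    (\int[mu]_t ((\sum_i v i t) `^ r)%:E <= ((S + #|I|%:R * e) `^ r)%:E)%E.
  move=> e0; pose w i := B i + e.
  have w0 i : 0 < w i by rewrite ltr_wpDl.
  have Sw : \sum_i w i = S + #|I|%:R * e.
    by rewrite /w big_split/= sumr_const mulr_natl.
  have Sw0 : 0 <= \sum_i w i by apply: sumr_ge0 => i _; exact: ltW.
  pose c i := (\sum_i w i) `^ (r - 1) * w i `^ (1 - r).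
  have c0 i : 0 <= c i by rewrite mulr_ge0 ?powR_ge0.
  rewrite -Sw; apply: (@le_trans _ _ (\int[mu]_t (\sum_i c i * v i t `^ r)%:E)%E).
    apply: ge0_le_integral => //.
    - by move=> t _; rewrite lee_fin powR_ge0.
    - apply/measurable_EFinP; apply: (@measurableT_comp _ _ _ _ _ _ (@powR R ^~ r)) => //.
      exact: measurable_sum.
    - by apply/measurable_EFinP; apply: measurable_sum => i; exact: measurable_funM.
    - move=> t _; rewrite lee_fin; under [leRHS]eq_bigr do rewrite /c -mulrA.
      by rewrite -mulr_sumr; exact: weighted_power_mean.
  rewrite (integral_lincomb c0 (fun i t => powR_ge0 _ _) mvr vB) lee_fin.
  under [leLHS]eq_bigr do rewrite /c -mulrA.
  rewrite -mulr_sumr; set W := \sum_i w i in Sw0 *.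
  have [W0|Wn0] := eqVneq W 0.
    rewrite big1 ?mulr0 ?powR_ge0// => i _.
    by move: (w0 i); rewrite (psumr_eq0P (fun i _ => ltW (w0 i)) W0)// ltxx.
  have -> : W `^ r = W `^ (r - 1) * W.
    by rewrite -[X in _ = _ * X](powRr1 Sw0) -powRD ?Wn0 ?implybT// subrK.
  rewrite ler_wpM2l ?powR_ge0//; apply: ler_sum => i _.
  rewrite [leRHS](_ : w i = w i `^ (1 - r) * w i `^ r); last first.
    by rewrite -powRD_gt0// subrK powRr1// ltW.
  rewrite ler_wpM2l ?powR_ge0//; apply: ler_powRl => //.
  by rewrite lerDl ltW.
have [I0|In0] := posnP #|I|.
  by have := eps 1 ltr01; rewrite I0 mul0r addr0.
have fin : (\int[mu]_t ((\sum_i v i t) `^ r)%:E)%E \is a fin_num.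
  rewrite ge0_fin_numE; first exact: le_lt_trans (eps 1 ltr01) (ltry _).
  by apply: integral_ge0 => t _; rewrite lee_fin powR_ge0.
move: eps; rewrite -(fineK fin) => eps.
rewrite lee_fin; set X := fine _ in eps *.
have X0 : 0 <= X by rewrite fine_ge0// integral_ge0// => t _; rewrite lee_fin powR_ge0.
rewrite -(powRKV X0 r0); apply: ler_powRl; rewrite ?powR_ge0//.
apply/ler_addgt0Pr => e e0.
have n0 : 0 < #|I|%:R :> R by rewrite ltr0n.
have := eps (e / #|I|%:R) (divr_gt0 e0 n0); rewrite lee_fin.
rewrite mulrC divfK ?gt_eqF// => XS.
have V0 : 0 <= r^-1 by rewrite invr_ge0.
have := ler_powRl V0 X0 XS.
by rewrite powRVK// addr_ge0// ltW.
Qed.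

End Minkowski.

(** * The Fourier type of complex L^p *)

Section VectorHausdorffYoung.
Context {d} {T : measurableType d} {R : realType} (mu : {measure set T -> \bar R}).
Context {p : R} (p1 : 1 <= p).
Local Notation X := (cLp mu p1).
Local Notation F := (cLfunType mu p1).

Lemma cLnorm_power (f : T -> R[i]) :
  (cLnorm mu p f `^ p = \int[mu]_t (rnorm (f t) `^ p)%:E)%E.
Proof.
have p0 : p != 0 by rewrite gt_eqF// (lt_le_trans ltr01).
transitivity (\int[mu]_t (`|(rnorm (f t))%:E| `^ p)%E)%E; first exact: powR_Lnorm.
by apply: eq_integral => t _ /=; rewrite ger0_norm ?rnorm_ge0// poweR_EFin.
Qed.

Lemma rnorm_pi_power (f : F) :
  (\int[mu]_t (rnorm (f t) `^ p)%:E = (rnorm (\pi_X f)%qT `^ p)%:E)%E.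
Proof.
have [mf ff] := cLfunP f.
have -> : rnorm (\pi_X f)%qT = fine (cLnorm mu p f).
  by rewrite /rnorm [X in complex.Re X](pi_cLp_norm f).
have fin : cLnorm mu p f \is a fin_num by rewrite ge0_fin_numE// cLnorm_ge0.
by rewrite -cLnorm_power -[in LHS](fineK fin) poweR_EFin.
Qed.

Lemma pi_lincomb (I : finType) (w : I -> R[i]) (f : I -> F) :
  (\pi_X (\sum_i w i *: f i))%qT = \sum_i w i *: (\pi_X (f i))%qT.
Proof.
elim: (index_enum I) => [|i r IH]; first by rewrite !big_nil piE.
by rewrite !big_cons pi_cLpD IH; congr (_ + _); exact/esym/pi_cLpZ.
Qed.

Lemma lincombE (I : finType) (w : I -> R[i]) (f : I -> F) t :
  (\sum_i w i *: f i) t = \sum_i w i * f i t.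
Proof.
elim: (index_enum I) => [|i r IH]; first by rewrite !big_nil.
by rewrite !big_cons -IH.
Qed.

Section kernel.
Context {J : finType} {n : nat} (W : J -> 'I_n -> R[i]) (L : R).
Hypothesis L0 : 0 < L.
Hypothesis ortho : forall i j,
  \sum_k W i k * (W j k)^* = real_complex R (L *+ (i == j)).
Hypothesis W1 : forall j k, rnorm (W j k) <= 1.

Let mnorm (f : F) (r : R) : measurable_fun setT (fun t => rnorm (f t) `^ r).
Proof.
apply: (@measurableT_comp _ _ _ _ _ _ (@powR R ^~ r)) => //.
exact/cmeasurable_rnorm/(cLfunP f).1.
Qed.

(** Here the outer sum commutes with the integral, and Minkowski's inequality in
    [L^(p-1)] is applied to the functions [|f_k|^(p/(p-1))]. *)
Lemma vector_hausdorff_young_ge2 (x : 'I_n -> X) : 2 <= p ->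
  \sum_j rnorm (\sum_k W j k *: x k) `^ p <=
  L * (\sum_k rnorm (x k) `^ (p / (p - 1))) `^ (p - 1).
Proof.
move=> p2; pose f k : F := repr (x k); pose Ff j : F := \sum_k W j k *: f k.
have p10 : p - 1 != 0 by lra.
have xE k : x k = (\pi_X (f k))%qT by rewrite /f reprK.
have WxE j : \sum_k W j k *: x k = (\pi_X (Ff j))%qT.
  by rewrite pi_lincomb; apply: eq_bigr => k _; rewrite -xE.
rewrite -lee_fin EFinM.
have -> : (\sum_j rnorm (\sum_k W j k *: x k) `^ p)%:E =
    (\int[mu]_t (\sum_j 1 * rnorm (Ff j t) `^ p)%:E)%E.
  rewrite (@integral_lincomb _ _ _ _ _ (fun=> 1) (fun j t => rnorm (Ff j t) `^ p)
    (fun j => rnorm (\sum_k W j k *: x k) `^ p))//.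
  - by congr EFin; apply: eq_bigr => j _; rewrite mul1r.
  - by move=> j t; exact: powR_ge0.
  - by move=> j; rewrite WxE; exact: rnorm_pi_power.
pose q := p / (p - 1).
have -> : (\sum_k rnorm (x k) `^ (p / (p - 1))) = \sum_k rnorm (\pi_X (f k))%qT `^ q.
  by apply: eq_bigr => k _; rewrite -xE.
apply: (@le_trans _ _ (\int[mu]_t (L * (\sum_k rnorm (f k t) `^ q) `^ (p - 1))%:E)%E).
  apply: ge0_le_integral => //.
  - by move=> t _; rewrite lee_fin sumr_ge0// => j _; rewrite mul1r powR_ge0.
  - by apply/measurable_EFinP; apply: measurable_sum => j; exact: measurable_funM.
  - apply/measurable_EFinP; apply: measurable_funM => //.
    apply: (@measurableT_comp _ _ _ _ _ _ (@powR R ^~ (p - 1))) => //.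
    exact: measurable_sum.
  - move=> t _; rewrite lee_fin; under eq_bigr do rewrite mul1r /Ff lincombE.
    exact: (hausdorff_young L0 ortho W1 p2 (fun k => f k t)).
under eq_integral do rewrite EFinM.
rewrite ge0_integralZl//; last 3 first.
- apply/measurable_EFinP; apply: (@measurableT_comp _ _ _ _ _ _ (@powR R ^~ (p - 1))) => //.
  exact: measurable_sum.
- by move=> t _; rewrite lee_fin powR_ge0.
- by rewrite lee_fin ltW.
rewrite lee_pmul2l ?lte_fin//; apply: minkowski_sum.
- lra.
- by move=> k t; exact: powR_ge0.
- by move=> k; exact: mnorm.
- by move=> k; exact: powR_ge0.
- move=> k; under eq_integral do rewrite -powRrM /q divfK//.
  by rewrite -powRrM /q divfK// rnorm_pi_power.
Qed.

(** Here [p] is the smaller exponent: the inner sum commutes with the integral,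
    and [minkowski_power_integral] is applied to the functions [|F_j|^p]. *)
Lemma vector_hausdorff_young_lt2 (x : 'I_n -> X) (q : R) : 2 < q -> p = q / (q - 1) ->
  \sum_j rnorm (\sum_k W j k *: x k) `^ q <=
  L * (\sum_k rnorm (x k) `^ p) `^ (q - 1).
Proof.
move=> q2 pq; pose f k : F := repr (x k); pose Ff j : F := \sum_k W j k *: f k.
have q10 : q - 1 != 0 by lra.
have xE k : x k = (\pi_X (f k))%qT by rewrite /f reprK.
have WxE j : \sum_k W j k *: x k = (\pi_X (Ff j))%qT.
  by rewrite pi_lincomb; apply: eq_bigr => k _; rewrite -xE.
have pqE : p * (q - 1) = q by rewrite pq divfK.
have -> : \sum_j rnorm (\sum_k W j k *: x k) `^ q =
    \sum_j (rnorm (\pi_X (Ff j))%qT `^ p) `^ (q - 1).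
  by apply: eq_bigr => j _; rewrite -powRrM pqE WxE.
apply: (@minkowski_power_integral _ _ _ mu _ (fun j t => rnorm (Ff j t) `^ p)
  (fun t => \sum_k 1 * rnorm (f k t) `^ p)).
- lra.
- exact: ltW.
- by move=> j t; exact: powR_ge0.
- by move=> j; exact: mnorm.
- by move=> t; apply: sumr_ge0 => k _; rewrite mul1r powR_ge0.
- by apply: measurable_sum => k; exact: measurable_funM.
- by move=> j; exact: rnorm_pi_power.
- rewrite (@integral_lincomb _ _ _ _ _ (fun=> 1) (fun k t => rnorm (f k t) `^ p)
    (fun k => rnorm (x k) `^ p))//.
  + by congr EFin; apply: eq_bigr => k _; rewrite mul1r.
  + by move=> k t; exact: powR_ge0.
  + by move=> k; rewrite xE; exact: rnorm_pi_power.
- move=> t; under eq_bigr do rewrite -powRrM pqE /Ff lincombE.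
  have -> : \sum_k 1 * rnorm (f k t) `^ p = psum (q / (q - 1)) (fun k => f k t).
    by rewrite /psum -pq; apply: eq_bigr => k _; rewrite mul1r.
  exact: (hausdorff_young L0 ortho W1 (ltW q2) (fun k => f k t)).
Qed.

Lemma vector_hausdorff_young (p' : R) (x : 'I_n -> X) : 1 < p -> p^-1 + p'^-1 = 1 ->
  \sum_j rnorm (\sum_k W j k *: x k) `^ Num.max p p' <=
  L * (\sum_k rnorm (x k) `^ Num.min p p') `^ (Num.max p p' - 1).
Proof.
move=> pgt1 pp'; have p0 : p != 0 by lra.
have p10 : p - 1 != 0 by lra.
have p'E : p' = p / (p - 1).
  have : p'^-1 = (p - 1) / p by apply: (addrI p^-1); rewrite pp'; field.
  by move=> /(congr1 GRing.inv); rewrite invrK invf_div.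
have [p2|p2] := leP 2 p.
  have le : p' <= p.
    by rewrite p'E ler_pdivrMr; [nra|lra].
  rewrite (max_idPl le) (min_idPr le) p'E.
  exact: vector_hausdorff_young_ge2.
have lt2 : 2 < p' by rewrite p'E ltr_pdivlMr; lra.
have le : p <= p' by lra.
rewrite (max_idPr le) (min_idPl le).
apply: vector_hausdorff_young_lt2 => //.
by rewrite p'E; field; rewrite p10/=; lra.
Qed.

End kernel.
End VectorHausdorffYoung.

(** * Completeness of complex L^p *)

Lemma sum_shift (V : nmodType) (u : nat -> V) (l N : nat) :
  \sum_(l <= m < N) u m = \sum_(i < N - l) u (i + l)%N.
Proof. by rewrite -{1}[l]add0n big_addn big_mkord. Qed.

Section RieszFischer.
Context {d} {T : measurableType d} {R : realType} (mu : {measure set T -> \bar R}).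
Context {p : R} (p1 : 1 <= p).
Local Notation X := (cLp mu p1).
Local Notation F := (cLfunType mu p1).

Let pgt0 : 0 < p. Proof. exact: lt_le_trans ltr01 p1. Qed.

(** Minkowski's inequality and monotone convergence for the sums of moduli, which
    increase with [N]. *)
Lemma tail_dominated (f : nat -> F) (l : nat) (e : R) : 0 <= e ->
  (forall N, \sum_(l <= m < N) rnorm (\pi_X (f m))%qT <= e) ->
  exists H : T -> \bar R, [/\ measurable_fun setT H, (forall t, 0 <= H t)%E,
    (forall N t, ((\sum_(l <= m < N) rnorm (f m t)) `^ p)%:E <= H t)%E &
    (\int[mu]_t H t <= (e `^ p)%:E)%E].
Proof.
move=> e0 fe.
pose h N t := ((\sum_(l <= m < N) rnorm (f m t)) `^ p)%:E.
have sum0 N t : 0 <= \sum_(l <= m < N) rnorm (f m t).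
  by apply: sumr_ge0 => m _; exact: rnorm_ge0.
have ndh t : nondecreasing_seq (h ^~ t).
  move=> a b ab; rewrite lee_fin; apply: ler_powRl => //; first exact: ltW.
  have [la|al] := leqP l a; last first.
    by rewrite [leLHS]big_geq// ltnW.
  rewrite (big_cat_nat la ab)/= lerDl; apply: sumr_ge0 => m _; exact: rnorm_ge0.
have mh N : measurable_fun setT (h N).
  apply/measurable_EFinP.
  apply: (@measurableT_comp _ _ _ _ _ _ (@powR R ^~ p)) => //.
  apply: measurable_sum => m; exact/cmeasurable_rnorm/(cLfunP (f m)).1.
have h0 N t : (0 <= h N t)%E by rewrite lee_fin powR_ge0.
have ch t : cvgn (h ^~ t) by exact: ereal_nondecreasing_is_cvgn.
exists (fun t => limn (h ^~ t)); split.
- exact: (emeasurable_fun_cvg h).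
- by move=> t; apply: lime_ge => //; exact: nearW.
- move=> N t; apply: lime_ge => //; near=> M; apply: ndh.
  by near: M; exact: nbhs_infty_ge.
- rewrite monotone_convergence//.
  apply: lime_le.
    apply: ereal_nondecreasing_is_cvgn => a b ab; apply: ge0_le_integral => //.
    by move=> t _; exact: ndh.
  apply: nearW => N; rewrite /h.
  under eq_integral do rewrite sum_shift.
  apply: (@le_trans _ _ (((\sum_(i < N - l) rnorm (\pi_X (f (i + l)%N))%qT) `^ p)%:E)).
    apply: (@minkowski_sum _ _ _ mu _ (fun (i : 'I_(N - l)) t => rnorm (f (i + l)%N t))
      (fun i => rnorm (\pi_X (f (i + l)%N))%qT)) => //.
    - by move=> i t; exact: rnorm_ge0.
    - by move=> i; exact/cmeasurable_rnorm/(cLfunP _).1.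
    - by move=> i; exact: rnorm_ge0.
    - by move=> i; exact: rnorm_pi_power.
  rewrite lee_fin; apply: ler_powRl; first exact: ltW.
    by apply: sumr_ge0 => i _; exact: rnorm_ge0.
  by apply: le_trans (fe N); rewrite sum_shift.
Unshelve. all: by end_near. Qed.

(** The Riesz-Fischer theorem in the form needed for Neumann series, with an
    explicit rate [e].  Where the dominating function of the whole series is
    finite, which is almost everywhere, the representatives converge absolutely;
    the domination of the tails then gives the rate. *)
Lemma cLp_series_converges (x : nat -> X) (e : nat -> R) : (forall l, 0 <= e l) ->
  (forall l N, \sum_(l <= m < N) rnorm (x m) <= e l) ->
  exists y, forall l, rnorm (y - \sum_(0 <= m < l) x m) <= e l.
Proof.
move=> e0 xe; pose f m : F := repr (x m).
have xE m : x m = (\pi_X (f m))%qT by rewrite /f reprK.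
have /choice[H HP] : forall l, exists H : T -> \bar R,
    [/\ measurable_fun setT H, (forall t, 0 <= H t)%E,
    (forall N t, ((\sum_(l <= m < N) rnorm (f m t)) `^ p)%:E <= H t)%E &
    (\int[mu]_t H t <= (e l `^ p)%:E)%E].
  move=> l; apply: tail_dominated => // N; apply: le_trans _ (xe l N).
  by rewrite le_eqVlt; apply/orP; left; apply/eqP; apply: eq_bigr => m _; rewrite -xE.
pose ReS N t := \sum_(0 <= m < N) complex.Re (f m t).
pose ImS N t := \sum_(0 <= m < N) complex.Im (f m t).
(* An upper limit is measurable without any convergence assumption and agrees
   with the limit wherever the series converges. *)
pose FR t := fine (limn_esup (fun N => (ReS N t)%:E)).
pose FI t := fine (limn_esup (fun N => (ImS N t)%:E)).
pose G t : R[i] := Complex (FR t) (FI t).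
have mlim (u : nat -> T -> R) : (forall N, measurable_fun setT (u N)) ->
    measurable_fun setT (fun t => fine (limn_esup (fun N => (u N t)%:E))).
  move=> mu_; apply: (measurableT_comp (fine_measurable measurableT)).
  apply: (@measurable_fun_limn_esup _ _ _ _ (fun N t => (u N t)%:E)) => N.
  exact/measurable_EFinP.
have mG : cmeasurable G.
  split; apply: mlim => N; apply: measurable_sum => m.
    exact: (cLfunP (f m)).1.1.
  exact: (cLfunP (f m)).1.2.
have cvgF t : (H 0%N t < +oo)%E -> ReS ^~ t @ \oo --> FR t /\ ImS ^~ t @ \oo --> FI t.
  move=> Ht.
  have abs (u : nat -> R) : (forall m, `|u m| <= rnorm (f m t)) ->
      (fun N => \sum_(0 <= m < N) u m) @ \oo -->
      fine (limn_esup (fun N => (\sum_(0 <= m < N) u m)%:E)).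
    move=> uf.
    have cu : cvgn (series u).
      apply: normed_cvg; apply: nondecreasing_is_cvgn.
        by apply: nondecreasing_series => *; exact: normr_ge0.
      exists (fine (H 0%N t) `^ p^-1) => _ [N _ <-].
      apply: (@le_trans _ _ (\sum_(0 <= m < N) rnorm (f m t))).
        by apply: ler_sum => m _; exact: uf.
      have [_ H0 HN _] := HP 0%N.
      have s0 : 0 <= \sum_(0 <= m < N) rnorm (f m t).
        by apply: sumr_ge0 => m _; exact: rnorm_ge0.
      rewrite -[leLHS](powRVK s0 (lt0r_neq0 pgt0)); apply: ler_powRl.
      - by rewrite invr_ge0 ltW.
      - exact: powR_ge0.
      - by rewrite -lee_fin fineK ?ge0_fin_numE.
    have ce : (fun N => (series u N)%:E) @ \oo --> (limn (series u))%:E.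
      by apply: cvg_EFin; [exact: nearW|].
    rewrite is_cvg_limn_esupE; last by apply/cvg_ex; eexists; exact: ce.
    by rewrite (cvg_lim _ ce).
  split; apply: abs => m; have [h1 h2] := ReIm_le_rnorm (f m t) => //.
have aefin : \forall t \ae mu, (H 0%N t < +oo)%E.
  have [mH H0 _ HI] := HP 0%N.
  have : mu.-integrable setT (H 0%N).
    apply/integrableP; split=> //; under eq_integral do rewrite gee0_abs//.
    exact: le_lt_trans HI (ltry _).
  move/(integrable_ae measurableT); apply: filterS => t /(_ I).
  by rewrite ge0_fin_numE.
pose S l : F := \sum_(i < l) 1 *: f i.
have SE l t : S l t = Complex (ReS l t) (ImS l t).
  rewrite /S lincombE; under eq_bigr do rewrite mul1r.
  rewrite /ReS /ImS !big_mkord -Re_sum -Im_sum; by case: (\sum_i _).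
have mGS l : cmeasurable (fun t => G t - S l t).
  rewrite (_ : (fun _ => _) = (-1) *: (S l : T -> R[i]) + G); last first.
    by apply/funext => t; rewrite [RHS](_ : _ = -1 * S l t + G t)// mulN1r addrC.
  by apply: cmeasurable_lin => //; exact: (cLfunP _).1.
have tail l t : (H 0%N t < +oo)%E -> ((rnorm (G t - S l t) `^ p)%:E <= H l t)%E.
  move=> Ht; have [cR cI] := cvgF t Ht; have [_ H0 HN _] := HP l.
  have [Hl|] := ltP (H l t) +oo%E; last by rewrite leye_eq => /eqP ->; rewrite leey.
  have Hfin : H l t \is a fin_num by rewrite ge0_fin_numE.
  rewrite -(fineK Hfin) lee_fin.
  rewrite -[leRHS](powRKV _ (lt0r_neq0 pgt0)) ?fine_ge0//.
  apply: ler_powRl; [exact: ltW|exact: rnorm_ge0|].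
  have cN : (fun N => Num.sqrt ((ReS N t - ReS l t) ^+ 2 + (ImS N t - ImS l t) ^+ 2)) @ \oo
     --> rnorm (G t - S l t).
    rewrite rnormE SE /=.
    apply: continuous_cvg; first exact: sqrt_continuous.
    rewrite !expr2; under eq_fun do rewrite !expr2.
    by apply: cvgD; apply: cvgM; apply: cvgB => //; exact: cvg_cst.
  rewrite -(cvg_lim _ cN)//; apply: limr_le; first by apply/cvg_ex; eexists; exact: cN.
  near=> N; have lN : (l <= N)%N by near: N; exact: nbhs_infty_ge.
  have -> : Num.sqrt ((ReS N t - ReS l t) ^+ 2 + (ImS N t - ImS l t) ^+ 2) =
      rnorm (\sum_(i < N - l) f (i + l)%N t).
    rewrite rnormE Re_sum Im_sum /ReS /ImS !(big_cat_nat (leq0n l) lN)/=.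
    rewrite ![\sum_(0 <= _ < l) _ + _]addrC !addrK.
    by rewrite !(sum_shift _ l N).
  apply: le_trans (rnorm_sum _) _.
  have -> : \sum_(i < N - l) rnorm (f (i + l)%N t) = \sum_(l <= m < N) rnorm (f m t).
    by rewrite sum_shift.
  have s0 : 0 <= \sum_(l <= m < N) rnorm (f m t).
    by apply: sumr_ge0 => m _; exact: rnorm_ge0.
  rewrite -[leLHS](powRVK s0 (lt0r_neq0 pgt0)); apply: ler_powRl.
  - by rewrite invr_ge0 ltW.
  - exact: powR_ge0.
  - by rewrite -lee_fin fineK.
have int l : (\int[mu]_t (rnorm (G t - S l t) `^ p)%:E <= (e l `^ p)%:E)%E.
  have [mH H0 _ HI] := HP l; apply: le_trans HI.
  apply: ae_ge0_le_integral => //.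
  - by move=> t _; rewrite lee_fin powR_ge0.
  - apply/measurable_EFinP; apply: (@measurableT_comp _ _ _ _ _ _ (@powR R ^~ p)) => //.
    exact: cmeasurable_rnorm.
  - by apply: filterS aefin => t Ht _; exact: tail.
have GL : G \in cLfun mu p.
  apply/asboolP; split=> //.
  have := int 0%N; rewrite /S big_ord0.
  have -> : (\int[mu]_t (rnorm (G t - (0 : F) t) `^ p)%:E)%E = (cLnorm mu p G `^ p)%E.
    rewrite [RHS](cLnorm_power mu p1); apply: eq_integral => t _.
    by rewrite [in LHS](_ : (0 : F) t = 0)// subr0.
  by case: (cLnorm mu p G) => [r _| |//]; rewrite ?ltry // poweRyr ?lt0r_neq0 // leye_eq.
pose Gf : F := CLfun p1 GL.
exists (\pi_X Gf)%qT => l.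
have -> : \sum_(0 <= m < l) x m = (\pi_X (S l))%qT.
  by rewrite /S pi_lincomb big_mkord; apply: eq_bigr => m _; rewrite scale1r xE.
(* The difference is written as a linear combination so that it has a visible
   representative. *)
have -> : (\pi_X Gf)%qT - (\pi_X (S l))%qT =
    (\pi_X (\sum_(i < 2) (if i == ord0 then 1 else -1) *:
                         (if i == ord0 then Gf else S l)))%qT.
  by rewrite [RHS]pi_lincomb !big_ord_recl big_ord0/= addr0 scale1r scaleN1r.
rewrite -[leLHS](powRVK (rnorm_ge0 _) (lt0r_neq0 pgt0)).
rewrite -[leRHS](powRVK (e0 l) (lt0r_neq0 pgt0)).
apply: ler_powRl; [by rewrite invr_ge0 ltW|exact: powR_ge0|].
rewrite -lee_fin -rnorm_pi_power; apply: le_trans (int l).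
rewrite le_eqVlt; apply/orP; left; apply/eqP; apply: eq_integral => t _.
by rewrite lincombE !big_ord_recl big_ord0/= addr0 mul1r mulN1r.
Unshelve. all: by end_near. Qed.

End RieszFischer.

(** * Roots of a point of the unit circle *)

Section UnitCircle.
Context {R : realType}.
Implicit Types x y : R.

Definition cis x : R[i] := Complex (cos x) (sin x).

Lemma cisD x y : cis (x + y) = cis x * cis y.
Proof.
by rewrite /cis cosD sinD; apply/eqP; rewrite eq_complex/= eqxx/=; apply/eqP; ring.
Qed.

Lemma cis0 : cis 0 = 1.
Proof. by rewrite /cis cos0 sin0. Qed.

Lemma cisX x n : cis x ^+ n = cis (n%:R * x).
Proof.
elim: n => [|n IH]; first by rewrite expr0 mul0r cis0.
by rewrite exprS IH -cisD; congr cis; rewrite -natr1; ring.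
Qed.

Lemma cis2pi : cis (2 * pi) = 1.
Proof. by rewrite /cis mulr_natl cos2pi sin2pi. Qed.

Lemma rnorm_cis x : rnorm (cis x) = 1.
Proof. by rewrite rnormE /= cos2Dsin2 sqrtr1. Qed.

Lemma conj_cis x : (cis x)^* = cis (- x).
Proof.
have h : cis x * (cis x)^* = cis x * cis (- x).
  by rewrite -sqr_rnorm rnorm_cis expr1n -cisD subrr cis0.
apply: (mulfI _ h); apply/negP => /eqP x0.
by have := rnorm_cis x; rewrite x0 rnorm0 => /eqP; rewrite eq_sym oner_eq0.
Qed.

Lemma cos_half x : cos x = 1 - 2 * sin (x / 2) ^+ 2.
Proof.
have {1}-> : x = (x / 2) *+ 2 by rewrite -mulr_natr divfK.
by rewrite cos_mulr2n cos2sin2 mulr2n; ring.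
Qed.

Lemma cis_neq1 x : 0 < `|x| < 2 * pi -> cis x != 1.
Proof.
move=> /andP[x0 x2]; apply/negP => /eqP/(congr1 (@complex.Re R))/= c1.
have : 0 < sin (`|x| / 2).
  by apply: sin_gt0_pi; rewrite divr_gt0//= ltr_pdivrMr// mulrC.
have := cos_half `|x|; rewrite cos_norm c1 => h.
by have -> : sin (`|x| / 2) = 0; [apply/eqP; rewrite -sqrf_eq0; apply/eqP; lra|rewrite ltxx].
Qed.

Lemma unit_circle_cis (z : R[i]) : rnorm z = 1 -> z != 1 ->
  exists t, [/\ 0 < t, t < 2 * pi & z = cis t].
Proof.
move=> z1 zn1; have ri : complex.Re z ^+ 2 + complex.Im z ^+ 2 = 1.
  apply/eqP; rewrite -(@eqrXn2 _ 1)//; first last.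
  - by rewrite addr_ge0// sqr_ge0.
  rewrite expr1n !expr1.
  by rewrite -[X in X == _]sqr_sqrtr ?addr_ge0 ?sqr_ge0// -rnormE z1 expr1n.
have re1 : -1 <= complex.Re z <= 1.
  by have := sqr_ge0 (complex.Im z) => h; apply/andP; split; nra.
have sa : Num.sqrt (1 - complex.Re z ^+ 2) = `|complex.Im z|.
  by rewrite -sqrtr_sqr; congr Num.sqrt; lra.
have ren1 : complex.Im z = 0 -> complex.Re z != 1.
  move=> im0; apply: contra zn1 => /eqP re; apply/eqP.
  by case: z re im0 {z1 ri re1 sa} => a b /= -> ->.
have [im0|im0] := leP 0 (complex.Im z).
  exists (acos (complex.Re z)).
  have lt1 : complex.Re z < 1.
    by rewrite lt_neqAle (andP re1).2 andbT; apply/negP => /eqP re; have := ren1; nra.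
  split.
  - by apply: acos_gt0; rewrite (andP re1).1.
  - by apply: (le_lt_trans (acos_lepi re1)); have := pi_gt0 R; lra.
  - rewrite /cis acosK// sin_acos// sa ger0_norm//; by case: (z).
exists (2 * pi - acos (complex.Re z)); split.
- by have := acos_lepi re1; have := pi_gt0 R; lra.
- have : 0 < acos (complex.Re z); last lra.
  by apply: acos_gt0; rewrite (andP re1).1/=; nra.
- rewrite /cis cosB sinB mulr_natl cos2pi sin2pi mul1r mul0r addr0 mul0r sub0r mul1r.
  by rewrite acosK// sin_acos// sa ltr0_norm// opprK; case: (z).
Qed.

Lemma rnorm_cisB1 x : 0 <= x <= 2 * pi -> rnorm (cis x - 1) = 2 * sin (x / 2).
Proof.
move=> /andP[x0 x2]; have s0 : 0 <= sin (x / 2).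
  by apply: sin_ge0_pi; rewrite divr_ge0//= ler_pdivrMr// mulrC.
rewrite rnormE/= oppr0 addr0.
have -> : (cos x - 1) ^+ 2 + sin x ^+ 2 = (2 * sin (x / 2)) ^+ 2.
  by rewrite sin2cos2 cos_half; ring.
by rewrite sqrtr_sqr ger0_norm// mulr_ge0.
Qed.

Lemma sin_le_id x : 0 <= x -> sin x <= x.
Proof.
rewrite le_eqVlt => /predU1P[<-|x0]; first by rewrite sin0.
have ds : forall y, y \in `]0, x[%R -> is_derive y (1 : R) (@sin R) (cos y).
  by move=> y _; exact: is_derive_sin.
have [c _] := MVT x0 ds (continuous_subspaceT (@continuous_sin R)).
rewrite sin0 !subr0 => ->.
by rewrite ler_piMl ?cos_le1// ltW.
Qed.

(** If [sin] dipped below its chord, the mean value theorem on either side of the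
    dip would find its derivative [cos] below and later above the slope of the
    chord, but [cos] decreases. *)
Lemma jordan_sin x : 0 <= x <= pi / 2 -> 2 / pi * x <= sin x.
Proof.
have pi0 := pi_gt0 R.
have pin0 : (pi : R) != 0 by rewrite gt_eqF.
move=> /andP[]; rewrite le_eqVlt => /predU1P[<- _|x0]; first by rewrite mulr0 sin0.
rewrite le_eqVlt => /predU1P[->|x1].
  have e : 2 / pi * (pi / 2) = 1 :> R by rewrite mulrA divfK // divff.
  by rewrite sin_pihalf e.
rewrite leNgt; apply/negP => lt.
have cs a b : {within `[a, b], continuous (@sin R)}.
  exact/continuous_subspaceT/continuous_sin.
have ds a b : forall y, y \in `]a, b[%R -> is_derive y (1 : R) (@sin R) (cos y).
  by move=> y _; exact: is_derive_sin.
have [a /itvP ha Ea] := MVT x0 (ds 0 x) (cs 0 x).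
have [b /itvP hb Eb] := MVT x1 (ds x (pi / 2)) (cs x (pi / 2)).
rewrite sin0 !subr0 in Ea; rewrite sin_pihalf in Eb.
have ab : a < b by rewrite (lt_trans (_ : a < x)) ?ha ?hb.
have : cos b < cos a.
  have a0 : 0 < a by rewrite ha.
  have b2 : b < pi / 2 by rewrite hb.
  by rewrite ltr_cos// in_itv/=; apply/andP; split; lra.
have lt1 : cos a < 2 / pi by rewrite -(ltr_pM2r x0) -Ea.
have lt2 : 2 / pi < cos b.
  have d0 : 0 < pi / 2 - x by lra.
  rewrite -(ltr_pM2r d0) -Eb mulrBr.
  have -> : 2 / pi * (pi / 2) = 1 :> R by rewrite mulrA divfK // divff.
  lra.
lra.
Qed.

Section roots.
Variables (n : nat) (t : R).
Hypothesis n0 : (0 < n)%N.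

Definition circle_root (k : nat) : R[i] := cis ((t + 2 * pi * k%:R) / n%:R).

Let nn0 : n%:R != 0 :> R. Proof. by rewrite pnatr_eq0 -lt0n. Qed.

Lemma cis_nat k : cis (2 * pi * k%:R) = 1.
Proof. by rewrite mulrC -cisX cis2pi expr1n. Qed.

Lemma circle_rootX k : circle_root k ^+ n = cis t.
Proof. by rewrite cisX mulrC divfK// cisD cis_nat mulr1. Qed.

Lemma rnorm_circle_rootX k i : rnorm (circle_root k ^+ i) = 1.
Proof. by rewrite cisX rnorm_cis. Qed.

(** The terms form a geometric progression whose ratio is an n-th root of unity
    different from 1 when [i <> j]. *)
Lemma circle_root_ortho (i j : 'I_n) :
  \sum_(k < n) circle_root k ^+ i * (circle_root k ^+ j)^* = real_complex R (n%:R *+ (i == j)).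
Proof.
have [->|ij] := eqVneq i j.
  rewrite (eq_bigr (fun=> 1)) => [|k _]; first by rewrite sumr_const card_ord mulr1n rmorph_nat.
  by rewrite -sqr_rnorm rnorm_circle_rootX expr1n.
rewrite mulr0n; pose w := cis (2 * pi * (i%:R - j%:R) / n%:R).
have wX k : circle_root k ^+ i * (circle_root k ^+ j)^* =
    cis ((i%:R - j%:R) * t / n%:R) * w ^+ k.
  by rewrite !cisX conj_cis -!cisD; congr cis; field.
have wn : w ^+ n = 1.
  rewrite cisX mulrC divfK// mulrBr cisD cis_nat mul1r -conj_cis cis_nat.
  by rewrite conjC1.
have wn1 : w != 1.
  have pi0 := pi_gt0 R.
  have pi20 : 0 < 2 * pi :> R by rewrite mulr_gt0.
  have n0' : 0 < n%:R :> R by rewrite ltr0n.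
  apply: cis_neq1; rewrite normrM normfV normrM (gtr0_norm pi20) (gtr0_norm n0').
  rewrite -mulrA; apply/andP; split.
    apply: mulr_gt0; [by []|apply: divr_gt0 => //].
    rewrite normr_gt0 subr_eq0 eqr_nat.
    by apply: contra ij => /eqP/val_inj ->.
  rewrite (gtr_pMr _ pi20) ltr_pdivrMr// mul1r.
  have := ltn_ord i; have := ltn_ord j; rewrite -!(ltr_nat R).
  have : 0 <= i%:R :> R by []. have : 0 <= j%:R :> R by [].
  by move=> *; rewrite ltr_norml; apply/andP; split; lra.
rewrite (eq_bigr _ (fun (k : 'I_n) _ => wX k)) -mulr_sumr.
have := subrX1 w n; rewrite wn subrr => /esym/eqP.
by rewrite mulf_eq0 subr_eq0 (negbTE wn1)/= => /eqP ->; rewrite mulr0.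
Qed.

End roots.
End UnitCircle.

(** * The sum over the roots and the constant K *)

Section KernelSum.
Context {R : realType}.

(** Split a partial sum of odd length into even and odd denominators: beyond the
    first term each group is at most [2^(-s)] times the partial sum of half the
    length. *)
Lemma riemann_partial_bound (s : R) (N : nat) : 1 < s ->
  series (riemannR s) N <= (1 - 2 `^ (1 - s))^-1.
Proof.
move=> s1; set c := 2 `^ (1 - s).
have c1 : c < 1.
  have h : 1 `^ (s - 1) < 2 `^ (s - 1) :> R.
    by apply: gt0_ltr_powR; rewrite ?nnegrE ?subr_gt0// ltr1n.
  by rewrite /c -opprB powRN invf_lt1 ?powR_gt0//; rewrite powR1 in h.
have s0 : 0 <= s by lra.
have r0 k : 0 <= riemannR s k by exact/ltW/riemannR_gt0.
have nd : nondecreasing_seq (series (riemannR s)) by apply: nondecreasing_series.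
have dbl M : series (riemannR s) (M.*2.+1) <= 1 + c * series (riemannR s) M.
  elim: M => [|M IH].
    by rewrite /series/= big_nat1 big_geq// mulr0 addr0 /riemannR powR1 invr1.
  rewrite doubleS /series /= !big_nat_recr//= in IH *.
  rewrite mulrDr addrA.
  apply: (@le_trans _ _ (1 + c * \sum_(0 <= k < M) riemannR s k +
     (riemannR s M.*2.+1 + riemannR s M.*2.+2))).
    by rewrite addrA !lerD2r.
  rewrite lerD2l.
  have e : c * riemannR s M = 2 * riemannR s M.*2.+1.
    rewrite /riemannR /c powRD ?(pnatr_eq0, implybT)// powRr1// powRN.
    rewrite (_ : M.*2.+2%:R = 2 * M.+1%:R) ?powRM//; first by rewrite invfM mulrA.
    by rewrite -natrM mul2n doubleS.
  rewrite e mulr_natl mulr2n lerD2l lef_pV2 ?posrE ?powR_gt0//.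
  by apply: ler_powRl; rewrite ?ler_nat.
have h : series (riemannR s) N <= 1 + c * series (riemannR s) N.
  apply: le_trans (dbl N); apply: nd; rewrite -addnn.
  exact: leq_trans (leq_addr N N) (leqnSn _).
rewrite -[leRHS]mul1r ler_pdivlMr ?subr_gt0// mulrBr mulr1 [_ * c]mulrC.
by rewrite lerBlDr.
Qed.

Lemma riemann_partial_le_zeta (s : R) (N : nat) : 1 < s ->
  series (riemannR s) N <= zeta_sum s.
Proof.
move=> s1; have s0 : 0 <= s by lra.
have nd : nondecreasing_seq (series (riemannR s)).
  by apply: nondecreasing_series => k _ _; exact/ltW/riemannR_gt0.
apply: nondecreasing_cvgn_le => //; apply: nondecreasing_is_cvgn => //.
by exists (1 - 2 `^ (1 - s))^-1 => _ [m _ <-]; exact: riemann_partial_bound.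
Qed.

Lemma zeta_sum_ge0 (s : R) : 1 < s -> 0 <= zeta_sum s.
Proof.
move=> s1; apply: le_trans (riemann_partial_le_zeta 0 s1).
by rewrite /series/= big_geq.
Qed.

Lemma ritt_K_powR (s : R) (z : R[i]) : 1 < s ->
  ritt_K s z `^ s = 2 * ((pi / (2 * rnorm (z - 1))) `^ s + zeta_sum s / 4 `^ s).
Proof.
move=> s1; have s0 : s != 0 by lra.
have A0 : 0 <= (pi / (2 * rnorm (z - 1))) `^ s + zeta_sum s / 4 `^ s.
  by rewrite addr_ge0 ?powR_ge0// divr_ge0 ?powR_ge0 ?zeta_sum_ge0.
by rewrite /ritt_K powRM ?powR_ge0// !powRKV.
Qed.

Lemma ritt_K_ge0 (s : R) (z : R[i]) : 0 <= ritt_K s z.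
Proof. by rewrite /ritt_K mulr_ge0 ?powR_ge0. Qed.

(** The first term gives the first summand of [K]; in the others [t > 0] is
    dropped, leaving the terms [(4 k)^(-s)] of the zeta sum. *)
Lemma progression_sum (s : R) (n : nat) (t a : R) : 1 < s -> 0 < a -> a <= t ->
  \sum_(k < n) (pi / (2 * (t + 2 * pi * k%:R))) `^ s <=
  (pi / (2 * a)) `^ s + zeta_sum s / 4 `^ s.
Proof.
move=> s1 a0 ta; have s0 : 0 <= s by lra.
have pi0 := pi_gt0 R.
have t0 : 0 < t by lra.
have z0 : 0 <= zeta_sum s / 4 `^ s by rewrite divr_ge0 ?powR_ge0 ?zeta_sum_ge0.
case: n => [|n]; first by rewrite big_ord0 addr_ge0 ?powR_ge0.
rewrite big_ord_recl/= mulr0 addr0; apply: lerD.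
  apply: ler_powRl => //; first by rewrite divr_ge0 ?mulr_ge0// ltW.
  by rewrite ler_pM2l// lef_pV2 ?posrE ?mulr_gt0// ler_pM2l.
apply: (@le_trans _ _ (\sum_(k < n) riemannR s k / 4 `^ s)).
  apply: ler_sum => k _; rewrite /riemannR /= /bump/= add1n.
  have kp : 0 < k.+1%:R :> R by rewrite ltr0n.
  have k4 : 0 <= k.+1%:R * 4 :> R by rewrite mulr_ge0// ltW.
  have -> : (k.+1%:R `^ s)^-1 / 4 `^ s = (k.+1%:R * 4)^-1 `^ s.
    rewrite -invfM -powRM//.
    by rewrite -[in RHS]powR_inv1// -powRrM mulN1r powRN.
  have pk : 0 < 2 * pi * k.+1%:R :> R by rewrite mulr_gt0 // mulr_gt0.
  have tk : 0 < 2 * (t + 2 * pi * k.+1%:R) by rewrite mulr_gt0// addr_gt0.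
  apply: ler_powRl => //; first by rewrite ltW// divr_gt0.
  have scale (w m : R) : w != 0 -> m != 0 -> (m * 4)^-1 = w / (2 * (2 * w * m)).
    by move=> w0 m0; field; rewrite m0 w0.
  rewrite (scale pi) ?gt_eqF//.
  rewrite ler_pM2l// lef_pV2 ?posrE//; last by rewrite mulr_gt0.
  by rewrite ler_pM2l// lerDr ltW.
rewrite -mulr_suml ler_pM2r ?invr_gt0 ?powR_gt0//.
apply: le_trans (riemann_partial_le_zeta n s1).
by rewrite /series/= big_mkord.
Qed.

(** By Jordan's inequality [n |l_k - 1|] is at least [2 / pi] times the distance
    from the argument of [l_k], scaled by [n], to the nearer of [0] and
    [2 pi n].  Bounding the maximum of the two reciprocals by their sum leaves
    two arithmetic progressions, one for each end of the circle, which explains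
    the factor 2 in [K]. *)
Lemma circle_root_sum (s : R) (n : nat) (t : R) : (0 < n)%N -> 1 < s ->
  0 < t < 2 * pi ->
  \sum_(k < n) (n%:R * rnorm (circle_root n t k - 1))^-1 `^ s <= ritt_K s (cis t) `^ s.
Proof.
move=> n0 s1 /andP[t0 t2]; rewrite ritt_K_powR// mulr_natl mulr2n.
have s0 : 0 <= s by lra.
have pi0 := pi_gt0 R.
have np : 0 < n%:R :> R by rewrite ltr0n.
set a := rnorm (cis t - 1).
have aE : a = 2 * sin (t / 2) by rewrite /a rnorm_cisB1// !ltW.
have a0 : 0 < a by rewrite aE mulr_gt0//; apply: sin_gt0_pi; apply/andP; split; lra.
have at1 : a <= t.
  have := @sin_le_id R (t / 2); rewrite aE; lra.
have at2 : a <= 2 * pi - t.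
  have -> : a = 2 * sin (pi - t / 2).
    by rewrite aE sinB sinpi cospi; congr (_ * _); ring.
  have := @sin_le_id R (pi - t / 2); lra.
pose b (k : 'I_n) := (pi / (2 * (t + 2 * pi * k%:R))) `^ s.
pose c (k : 'I_n) := (pi / (2 * (2 * pi - t + 2 * pi * (rev_ord k)%:R))) `^ s.
apply: (@le_trans _ _ (\sum_k b k + \sum_k c k)); last first.
  apply: lerD; first exact: progression_sum.
  rewrite (reindex_inj rev_ord_inj)/=.
  under eq_bigr do rewrite /c rev_ordK.
  exact: progression_sum.
rewrite -big_split/=; apply: ler_sum => k _.
have k0 : 0 <= k%:R :> R by [].
have kn : k%:R + 1 <= n%:R :> R by rewrite natr1 ler_nat.
set x := (t + 2 * pi * k%:R) / n%:R.
have tk : 0 < t + 2 * pi * k%:R by rewrite ltr_wpDr// mulr_ge0// mulr_ge0// ltW.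
have x0 : 0 < x by rewrite divr_gt0.
have tk2 : t + 2 * pi * k%:R < 2 * pi * n%:R by nra.
have x2 : x < 2 * pi by rewrite ltr_pdivrMr.
have nx : n%:R * x = t + 2 * pi * k%:R by rewrite /x mulrC divfK// gt_eqF.
rewrite (_ : rnorm (circle_root n t k - 1) = 2 * sin (x / 2)); last first.
  by rewrite rnorm_cisB1// !ltW.
have low y u : 0 < y -> 2 / pi * (y / 2) <= u -> n%:R * y > 0 ->
    (n%:R * (2 * u))^-1 `^ s <= (pi / (2 * (n%:R * y))) `^ s.
  move=> y0 yu ny.
  have u0 : 0 < u by apply: lt_le_trans yu; rewrite mulr_gt0// divr_gt0.
  apply: ler_powRl => //; first by rewrite invr_ge0 !mulr_ge0// ltW.
  have scale (w m : R) : w != 0 -> m != 0 ->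
      w / (2 * (m * y)) = (m * (2 * (2 / w * (y / 2))))^-1.
    by move=> w0 m0; field; rewrite m0 w0 gt_eqF.
  rewrite (scale pi) ?gt_eqF//.
  have v0 : 0 < 2 / pi * (y / 2) by apply: mulr_gt0; exact: divr_gt0.
  rewrite lef_pV2 ?posrE; first by rewrite ler_pM2l// ler_pM2l.
  - by apply: mulr_gt0 => //; exact: mulr_gt0.
  - by apply: mulr_gt0 => //; exact: mulr_gt0.
have [xpi|xpi] := leP x pi.
  apply: (@le_trans _ _ (b k)); last by rewrite lerDl powR_ge0.
  rewrite /b -nx; apply: low => //; last by rewrite nx.
  by apply: jordan_sin; apply/andP; split; lra.
apply: (@le_trans _ _ (c k)); last by rewrite lerDr powR_ge0.
have ny : n%:R * (2 * pi - x) = 2 * pi - t + 2 * pi * (rev_ord k)%:R.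
  rewrite mulrBr nx /= natrB// -natr1; ring.
have y0 : 0 < 2 * pi - x by lra.
rewrite /c -ny; apply: low => //; last by rewrite mulr_gt0.
have -> : sin (x / 2) = sin ((2 * pi - x) / 2).
  have -> : (2 * pi - x) / 2 = pi - x / 2 by field.
  by rewrite sinB sinpi cospi; ring.
by apply: jordan_sin; apply/andP; split; lra.
Qed.

End KernelSum.

(** * Resolvents of Ritt operators on the unit circle *)

Section Operators.
Context {R : realType} {V : normedModType R[i]}.
Implicit Types (A B : V -> V) (x y : V).

Lemma rnormZ (a : R[i]) x : rnorm (a *: x) = rnorm a * rnorm x.
Proof. by apply: complexI; rewrite rmorphM/= !rnormK normrZ. Qed.

Lemma rnormN (U : normedZmodType R[i]) (x : U) : rnorm (- x) = rnorm x.
Proof. by rewrite /rnorm normrN. Qed.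

Lemma rnormZ_unit (a : R[i]) x : rnorm a = 1 -> rnorm (a *: x) = rnorm x.
Proof. by move=> a1; rewrite rnormZ a1 mul1r. Qed.

Lemma rnorm_gt0 (U : normedZmodType R[i]) (x : U) : x != 0 -> 0 < rnorm x.
Proof.
move=> x0; rewrite lt_neqAle rnorm_ge0 andbT eq_sym.
by apply: contra x0 => /eqP/rnorm0_eq0 ->.
Qed.

Lemma unit_vector x : x != 0 ->
  rnorm (real_complex R (rnorm x)^-1 *: x) = 1.
Proof.
move=> /rnorm_gt0 x0; rewrite rnormZ rnormC ?invr_ge0 ?ltW// mulVf// gt_eqF//.
Qed.

Section linear_op.
Variable A : V -> V.
Hypothesis linA : linear A.
Let A' : {linear V -> V} := HB.pack A (GRing.isLinear.Build R[i] V V *:%R A linA).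

Lemma linop0 : A 0 = 0. Proof. exact: (linear0 A'). Qed.

Lemma linopZ a x : A (a *: x) = a *: A x. Proof. exact: (linearZ_LR A' a x). Qed.

Lemma linopD x y : A (x + y) = A x + A y. Proof. exact: (linearD A' x y). Qed.

Lemma linopB x y : A (x - y) = A x - A y. Proof. exact: (linearB A' x y). Qed.

Lemma linop_sum (I : finType) (f : I -> V) : A (\sum_i f i) = \sum_i A (f i).
Proof. exact: (linear_sum A'). Qed.

End linear_op.

Lemma opnorm_leP A M : linear A -> 0 <= M ->
  (opnorm A <= M%:E)%E <-> forall x, rnorm (A x) <= M * rnorm x.
Proof.
move=> linA M0; split=> [AM x|AM].
  have [->|x0] := eqVneq x 0; first by rewrite (linop0 linA) rnorm0 mulr0.
  have u1 := unit_vector x0; have xp := rnorm_gt0 x0.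
  have : ((rnorm (A (real_complex R (rnorm x)^-1 *: x)))%:E <= M%:E)%E.
    apply: le_trans AM; apply: ereal_sup_ubound.
    by exists (real_complex R (rnorm x)^-1 *: x) => //=; rewrite u1.
  have xp' : 0 <= (rnorm x)^-1 by rewrite invr_ge0 ltW.
  by rewrite (linopZ linA) rnormZ rnormC// lee_fin mulrC ler_pdivrMr.
apply: ge_ereal_sup => _ [x /= x1 <-]; rewrite lee_fin.
by apply: le_trans (AM x) _; rewrite ler_piMr.
Qed.

(** The lower bound makes the preimage unique, hence linear, and bounds it. *)
Lemma bounded_inverse_of_lower_bound A M : linear A -> 0 <= M ->
  (forall y, rnorm y <= M * rnorm (A y)) -> (forall x, exists y, A y = x) ->
  exists B, bounded_inverse A B.
Proof.
move=> linA M0 AM /choice[B BK].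
have injA : injective A.
  move=> x y xy; apply/eqP; rewrite -subr_eq0; apply/eqP/rnorm0_eq0/eqP.
  by rewrite eq_le rnorm_ge0 andbT (le_trans (AM _))// (linopB linA) xy subrr rnorm0 mulr0.
have linB : linear B.
  by move=> a x y; apply: injA; rewrite (linopD linA) (linopZ linA) !BK.
exists B; split=> //; last by move=> y; apply: injA; rewrite /= BK.
split=> //; apply: (@le_lt_trans _ _ M%:E); last exact: ltry.
by apply/opnorm_leP => // x; rewrite -{2}[x]BK.
Qed.

Lemma resolventP A (l : R[i]) : resolvent_set A l ->
  bounded_inverse (fun x => l *: x - A x) (resolvent A l).
Proof. by move=> h; exact: xgetPex h. Qed.

Lemma opnorm_resolvent_le A (l : R[i]) M : resolvent_set A l -> 0 <= M ->
  (forall y, rnorm y <= M * rnorm (l *: y - A y)) ->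
  (opnorm (resolvent A l) <= M%:E)%E.
Proof.
move=> /resolventP[[linB _] _ BK] M0 AM.
by apply/opnorm_leP => // x; rewrite -{2}[x]BK.
Qed.

Lemma opnorm_ge0 A : (0 <= opnorm A)%E.
Proof.
apply: (@le_trans _ _ (rnorm (A 0))%:E); first by rewrite lee_fin rnorm_ge0.
by apply: ereal_sup_ubound; exists 0 => //=; rewrite rnorm0 ler01.
Qed.

Section ritt.
Variable T : V -> V.
Hypothesis Tc : contraction_op T.
Hypothesis Tr : ritt_operator T.
Let C := fine (ritt_constant T).

Let linT : linear T := Tc.1.

Lemma contraction_rnorm x : rnorm (T x) <= rnorm x.
Proof. by rewrite -[leRHS]mul1r; apply: (opnorm_leP linT _).1; last exact: Tc.2. Qed.

Lemma ritt_constant_ge0 : 0 <= C.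
Proof.
apply: fine_ge0.
have two : 1 < rnorm (2 : R[i]).
  by rewrite (_ : 2 = real_complex R 2) ?rnormC ?ltr1n// rmorph_nat.
apply: le_trans (ereal_sup_ubound (ex_intro2 _ _ (2 : R[i]) two erefl)).
by rewrite mule_ge0 ?opnorm_ge0// lee_fin rnorm_ge0.
Qed.

Lemma ritt_resolvent (m : R[i]) : 1 < rnorm m ->
  exists B, [/\ cancel B (fun x => m *: x - T x),
                cancel (fun x => m *: x - T x) B &
                forall x, rnorm (B x) <= C / rnorm (m - 1) * rnorm x].
Proof.
move=> m1; have [_ spT ritt] := Tr.
have mres : resolvent_set T m.
  by apply: contrapT => /spT/=; rewrite leNgt m1.
have [[linB Bfin] BK KB] := resolventP mres.
exists (resolvent T m); split=> //.
have m10 : 0 < rnorm (m - 1).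
  apply: rnorm_gt0; rewrite subr_eq0; apply: contraTN m1 => /eqP ->.
  by rewrite -leNgt /rnorm normr1.
have M0 : 0 <= C / rnorm (m - 1).
  by apply: divr_ge0; [exact: ritt_constant_ge0|exact: ltW].
apply/opnorm_leP => //.
have Bf : opnorm (resolvent T m) \is a fin_num by rewrite ge0_fin_numE ?opnorm_ge0.
rewrite -(fineK Bf) lee_fin ler_pdivlMr// mulrC -lee_fin EFinM fineK//.
have Cf : ritt_constant T \is a fin_num.
  rewrite ge0_fin_numE//; apply: (@le_trans _ _ ((rnorm (m - 1))%:E * opnorm (resolvent T m))%E).
    by rewrite mule_ge0 ?opnorm_ge0// lee_fin ltW.
  by apply: ereal_sup_ubound; exists m.
by rewrite /C fineK//; apply: ereal_sup_ubound; exists m.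
Qed.

(** Moving radially away from the circle also moves away from 1, so the Ritt bound
    at [r l] is at least as good as the one expected at [l]. *)
Lemma radial_distance (l : R[i]) (r : R) : rnorm l = 1 -> 1 <= r ->
  rnorm (l - 1) <= rnorm (real_complex R r * l - 1).
Proof.
move=> l1 r1; rewrite !rnormE ler_wsqrtr//.
have [h _] := ReIm_le_rnorm l; rewrite l1 in h.
have : complex.Re l ^+ 2 + complex.Im l ^+ 2 = 1.
  by have := sqr_sqrtr (addr_ge0 (sqr_ge0 (complex.Re l)) (sqr_ge0 (complex.Im l)));
    rewrite -rnormE l1 expr1n.
have a1 : complex.Re l <= 1 by apply: le_trans h; exact: ler_norm.
case: l {l1 h} a1 => a b /= a1 ab.
have : 0 <= (r - 1) * (r + 1 - 2 * a) by rewrite mulr_ge0//; lra.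
by rewrite !mul0r !subr0 !addr0; nra.
Qed.

Section boundary.
Variable l : R[i].
Hypotheses (l1 : rnorm l = 1) (ln1 : l != 1).
Let D := C / rnorm (l - 1).

Let l10 : 0 < rnorm (l - 1).
Proof. by apply: rnorm_gt0; rewrite subr_eq0. Qed.

Let D0 : 0 <= D.
Proof. by apply: divr_ge0; [exact: ritt_constant_ge0|exact: ltW]. Qed.

Lemma outer_resolvent (e : R) : 0 < e ->
  exists B, [/\ cancel B (fun x => (real_complex R (1 + e) * l) *: x - T x),
                cancel (fun x => (real_complex R (1 + e) * l) *: x - T x) B &
                forall x, rnorm (B x) <= D * rnorm x].
Proof.
move=> e0; have r1 : 1 < 1 + e by lra.
have [|B [BK KB Bb]] := @ritt_resolvent (real_complex R (1 + e) * l).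
  by rewrite rnormM l1 mulr1 rnormC// ltW// (lt_trans _ r1).
exists B; split=> // x; apply: le_trans (Bb x) _.
rewrite ler_wpM2r ?rnorm_ge0// ler_wpM2l ?ritt_constant_ge0//.
have h := radial_distance l1 (ltW r1).
by rewrite lef_pV2 ?posrE// (lt_le_trans l10 h).
Qed.

(** Apply the resolvent at [(1 + e) l] and let [e] tend to 0. *)
Lemma boundary_lower_bound y : rnorm y <= D * rnorm (l *: y - T y).
Proof.
apply/ler_addgt0Pr => d d0.
have Dy0 : 0 <= D * rnorm y by rewrite mulr_ge0 ?rnorm_ge0.
have e0 : 0 < d / (D * rnorm y + 1) by rewrite divr_gt0//; lra.
have [B [_ KB Bb]] := outer_resolvent e0; set e := d / _ in e0 KB Bb *.
rewrite -{1}[y]KB; apply: le_trans (Bb _) _.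
have -> : (real_complex R (1 + e) * l) *: y - T y =
    (l *: y - T y) + (real_complex R e * l) *: y.
  by rewrite rmorphD/= rmorph1 mulrDl mul1r scalerDl -!addrA; congr (_ + _); rewrite addrC.
apply: (@le_trans _ _ (D * (rnorm (l *: y - T y) + e * rnorm y))).
  rewrite ler_wpM2l//; apply: le_trans (ler_rnormD _ _) _.
  by rewrite lerD2l rnormZ rnormM l1 mulr1 rnormC// ltW.
rewrite mulrDr lerD2l mulrCA /e mulrAC ler_pdivrMr; last lra.
by rewrite ler_wpM2l ?(ltW d0)//; lra.
Qed.

End boundary.
End ritt.
End Operators.

(** * Powers of a Ritt contraction *)

Section RittContraction.
Context {R : realType} {V : normedModType R[i]}.
Implicit Types (x y : V).

(** Completeness as it is used: a series whose tails of norms are at most [e l]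
    has a sum, approached at the rate [e l]. *)
Definition series_complete := forall (x : nat -> V) (e : nat -> R),
  (forall l, 0 <= e l) ->
  (forall l N, \sum_(l <= m < N) rnorm (x m) <= e l) ->
  exists y, forall l, rnorm (y - \sum_(0 <= m < l) x m) <= e l.

(** Fourier type [s] with constant 1, for the characters twisted by the n-th roots
    of [cis t]. *)
Definition fourier_type (s s' : R) := forall (n : nat) (t : R) (x : 'I_n -> V),
  (0 < n)%N ->
  \sum_(j < n) rnorm (\sum_(k < n) circle_root n t k ^+ j *: x k) `^ s' <=
  n%:R * (\sum_(k < n) rnorm (x k) `^ s) `^ (s' - 1).

Variable T : V -> V.
Hypothesis Tc : contraction_op T.
Hypothesis Tr : ritt_operator T.
Let C := fine (ritt_constant T).
Let linT : linear T := Tc.1.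

Lemma geometric_tail (l N : nat) :
  \sum_(l <= m < N) (2^-1 : R) ^+ m <= 2 * 2^-1 ^+ l.
Proof.
have [lN|Nl] := leqP l N; last first.
  by rewrite big_geq ?mulr_ge0 ?exprn_ge0// ltnW.
rewrite (eq_bigr (fun m => - (2 * 2^-1 ^+ m.+1) - - (2 * 2^-1 ^+ m))) => [|m _].
  rewrite telescope_sumr// opprK addrC gerBl.
  by rewrite mulr_ge0// exprn_ge0.
by rewrite opprK exprS; field.
Qed.

(** A Neumann series around the point [(1 + e) l] outside the disc, where [e] is
    chosen so that each term has at most half the norm of the preceding one. *)
Lemma boundary_surjective (l : R[i]) : series_complete -> rnorm l = 1 -> l != 1 ->
  forall x, exists y, l *: y - T y = x.
Proof.
move=> compl l1 ln1 x; set D := C / rnorm (l - 1).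
have D0 : 0 <= D.
  by apply: divr_ge0; [exact: ritt_constant_ge0|exact: rnorm_ge0].
pose e := (2 * (D + 1))^-1.
have e0 : 0 < e by rewrite invr_gt0; lra.
have eD : e * D <= 2^-1.
  by rewrite mulrC ler_pdivrMr; lra.
have [B [BK _ Bb]] := outer_resolvent Tr l1 ln1 e0.
pose c := real_complex R e * l.
have rc : rnorm c = e by rewrite rnormM l1 mulr1 rnormC// ltW.
pose v := fix v m := if m is m'.+1 then c *: B (v m') else B x.
pose Q y := (real_complex R (1 + e) * l) *: y - T y.
have QE y : Q y = (l *: y - T y) + c *: y.
  by rewrite /Q rmorphD/= rmorph1 mulrDl mul1r scalerDl -!addrA; congr (_ + _); rewrite addrC.
have QD y z : Q (y + z) = Q y + Q z.
  by rewrite /Q scalerDr (linopD linT) opprD addrACA.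
have QZ a y : Q (a *: y) = a *: Q y.
  by rewrite /Q (linopZ linT) scalerBr !scalerA mulrC.
have vb m : rnorm (v m) <= 2^-1 ^+ m * rnorm (v 0%N).
  elim: m => [|m IH]; first by rewrite mul1r.
  rewrite [v _]/= rnormZ rc exprS -mulrA.
  apply: (@le_trans _ _ (e * D * rnorm (v m))).
    by rewrite -mulrA ler_wpM2l ?(ltW e0)//; exact: Bb.
  apply: (@le_trans _ _ (2^-1 * rnorm (v m))); first by rewrite ler_wpM2r ?rnorm_ge0.
  by rewrite ler_wpM2l.
pose w := rnorm (v 0%N); have w0 : 0 <= w by exact: rnorm_ge0.
have [||y yP] := compl v (fun l => 2 * 2^-1 ^+ l * w).
- by move=> k; rewrite !mulr_ge0 ?exprn_ge0.
- move=> k N; apply: le_trans (ler_sum _ (fun m _ => vb m)) _.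
  by rewrite -mulr_suml ler_wpM2r// geometric_tail.
exists y; apply/eqP; rewrite -subr_eq0; apply/eqP/rnorm0_eq0/eqP.
set N := rnorm _; rewrite eq_le rnorm_ge0 andbT.
pose s k := \sum_(0 <= m < k) v m.
have Qs k : Q (s k.+1) = x + c *: s k.
  elim: k => [|k IH].
    by rewrite /s big_nat1 big_geq// scaler0 addr0 /= /Q BK.
  rewrite /s big_nat_recr//= -/(s k.+1) QD IH QZ /Q BK -addrA -scalerDr.
  by rewrite /s big_nat_recr.
(* The partial sums solve the equation up to their last term. *)
have sE k : l *: s k.+1 - T (s k.+1) - x = - (c *: v k).
  apply: (addIr (x + c *: s k.+1)); rewrite addrA subrK -QE Qs.
  by rewrite {2}/s big_nat_recr//= -/(s k) scalerDr [_ + c *: v k]addrC [x + (_ + _)]addrCA addKr.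
have Nk k : N <= (2 * w + e * w) * 2^-1 ^+ k.
  have -> : N = rnorm ((l *: (y - s k.+1) - T (y - s k.+1)) - c *: v k).
    rewrite -(sE k) /N; congr rnorm.
    have LB a b : l *: (a - b) - T (a - b) = (l *: a - T a) - (l *: b - T b).
      by rewrite scalerBr (linopB linT) [- (T a - _)]opprD addrACA -opprD.
    by rewrite LB [RHS]addrA subrK.
  apply: le_trans (ler_rnormD _ _) _; rewrite rnormN rnormZ rc.
  have h1 : rnorm (l *: (y - s k.+1) - T (y - s k.+1)) <= 2 * (2 * 2^-1 ^+ k.+1 * w).
    apply: le_trans (ler_rnormD _ _) _; rewrite rnormN rnormZ l1 mul1r mulr_natl mulr2n.
    apply: lerD; first exact: yP.
    by apply: le_trans (contraction_rnorm Tc _) _; exact: yP.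
  have h2 : e * rnorm (v k) <= e * (2^-1 ^+ k * w) by rewrite ler_wpM2l ?(ltW e0).
  apply: le_trans (lerD h1 h2) _; rewrite exprS le_eqVlt; apply/orP; left; apply/eqP.
  by field.
have cv : (2 * w + e * w) * 2^-1 ^+ k @[k --> \oo] --> (2 * w + e * w) * 0.
  by apply: cvgMl_tmp; apply: cvg_expr; rewrite gtr0_norm ?invr_gt0// invf_lt1// ltr1n.
rewrite -[leRHS](mulr0 (2 * w + e * w)) -(cvg_lim _ cv)//.
apply: limr_ge; first by apply/cvg_ex; eexists; exact: cv.
exact: nearW.
Qed.

Lemma linear_iter n : linear (iter n T).
Proof.
by elim: n => [//|n IH] a x y; rewrite /= IH linT.
Qed.

Lemma rnorm_iter_le n x m : (m <= n)%N -> rnorm (iter n T x) <= rnorm (iter m T x).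
Proof.
move=> mn; rewrite -(subnK mn) iterD; elim: (n - m)%N => //= k IH.
by apply: le_trans IH; exact: contraction_rnorm.
Qed.

Section power.
Variables (n : nat) (t : R).
Hypotheses (n0 : (0 < n)%N) (t0 : 0 < t < 2 * pi).
Local Notation z := (cis t).
Local Notation root k := (circle_root n t k).

(** This is [l * (l^n - T^n) / (l - T)] for the root [l] of [z] with index [k],
    written with the conjugates of the powers of [l]. *)
Definition trig_poly (k : nat) x : V :=
  z *: \sum_(i < n) (root k ^+ i)^* *: iter i T x.

Lemma root_conjX k i : root k ^+ i * (root k ^+ i)^* = 1.
Proof. by rewrite -sqr_rnorm rnorm_circle_rootX expr1n. Qed.

Lemma root_conjXn k : z * (root k ^+ n)^* = 1.
Proof. by rewrite -{1}(circle_rootX t n0 k) root_conjX. Qed.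

Lemma trig_poly_resolvent k x :
  trig_poly k (root k *: x - T x) = root k *: (z *: x - iter n T x).
Proof.
pose f i := (root k * (root k ^+ i)^*) *: iter i T x.
have fS i : (root k ^+ i)^* *: iter i T (root k *: x - T x) = f i - f i.+1.
  rewrite (linopB (linear_iter i)) (linopZ (linear_iter i)) scalerBr scalerA mulrC.
  rewrite /f -iterSr; congr (_ - _ *: _).
  by rewrite exprS rmorphM/= mulrA -{2}[root k]expr1 -{3}[root k]expr1 root_conjX mul1r.
rewrite /trig_poly (eq_bigr _ (fun (i : 'I_n) _ => fS i)).
have -> : \sum_(i < n) (f i - f i.+1) = f 0%N - f n.
  have := telescope_sumr f (leq0n n); rewrite big_mkord => h.
  rewrite -opprB -h -sumrN; apply: eq_bigr => i _.
  by rewrite opprB.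
rewrite /f expr0 conjC1 mulr1 /= !scalerBr !scalerA; congr (_ *: _ - _ *: _).
  by rewrite mulrC.
by rewrite mulrCA root_conjXn mulr1.
Qed.

Lemma trig_poly_commute k x :
  root k *: trig_poly k x - T (trig_poly k x) = trig_poly k (root k *: x - T x).
Proof.
rewrite /trig_poly (linopZ linT) scalerA mulrC -scalerA -scalerBr; congr (_ *: _).
rewrite (linop_sum linT) scaler_sumr -sumrB; apply: eq_bigr => i _.
rewrite (linopB (linear_iter i)) (linopZ (linear_iter i)) scalerBr.
by rewrite (linopZ linT) -iterS iterSr !scalerA mulrC.
Qed.

(** The orbit is recovered from its Fourier coefficients. *)
Lemma trig_poly_inversion (j : 'I_n) x :
  \sum_(k < n) root k ^+ j *: trig_poly k x = (n%:R * z) *: iter j T x.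
Proof.
rewrite /trig_poly; under eq_bigr do rewrite scalerA mulrC -scalerA scaler_sumr.
rewrite -scaler_sumr exchange_big/= mulrC -scalerA; congr (_ *: _).
rewrite (bigD1 j)//= [X in _ + X]big1 ?addr0 => [|i ij].
  under eq_bigr do rewrite scalerA; rewrite -scaler_suml (circle_root_ortho t n0).
  by rewrite eqxx mulr1n rmorph_nat.
under eq_bigr do rewrite scalerA; rewrite -scaler_suml (circle_root_ortho t n0).
by rewrite eq_sym (negbTE ij) mulr0n scale0r.
Qed.

Lemma circle_root_neq1 k : root k != 1.
Proof.
apply/negP => /eqP k1; have := circle_rootX t n0 k; rewrite k1 expr1n.
have : z != 1 by apply: cis_neq1; rewrite gtr0_norm// (andP t0).1.
by move=> /[swap] <-; rewrite eqxx.
Qed.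

(** The partial fraction decomposition of [1 / (z - T^n)] over the roots of
    [z]. *)
Lemma power_surjective : series_complete ->
  forall x, exists y, z *: y - iter n T y = x.
Proof.
move=> compl x.
have /choice[w wP] : forall k, exists w, root k *: w - T w = x.
  move=> k; apply: boundary_surjective => //; last exact: circle_root_neq1.
  by rewrite rnorm_cis.
have nz : n%:R * z != 0.
  rewrite mulf_neq0 ?pnatr_eq0 -?lt0n//; apply/negP => /eqP z0.
  by have := rnorm_cis t; rewrite z0 rnorm0 => /eqP; rewrite eq_sym oner_eq0.
pose S y := z *: y - iter n T y.
have SD y y' : S (y + y') = S y + S y'.
  by rewrite /S scalerDr (linopD (linear_iter n)) opprD addrACA.
have SZ a y : S (a *: y) = a *: S y.
  by rewrite /S (linopZ (linear_iter n)) scalerBr !scalerA mulrC.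
have S0 : S 0 = 0 by rewrite /S scaler0 (linop0 (linear_iter n)) subr0.
exists ((n%:R * z)^-1 *: \sum_(k < n) root k *: w k).
rewrite -/(S _) SZ (big_morph S SD S0).
have -> : \sum_(k < n) S (root k *: w k) = (n%:R * z) *: x.
  transitivity (\sum_(k < n) root k ^+ (Ordinal n0) *: trig_poly k x).
    by apply: eq_bigr => k _; rewrite expr0 scale1r SZ -trig_poly_resolvent wP.
  by rewrite trig_poly_inversion.
by rewrite scalerA mulVf// scale1r.
Qed.

(** Fourier type applied to the vectors [trig_poly k x]: the boundary resolvent
    bounds each of them, and by contractivity each [|T^j x|] in the inversion
    formula is at least [|T^n x|]. *)
Lemma power_norm_bound (s s' : R) x : fourier_type s s' -> 1 < s -> 1 < s' ->
  s * (s' - 1) = s' ->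
  rnorm (iter n T x) <= C * ritt_K s z * rnorm (z *: x - iter n T x).
Proof.
move=> ft s1 s1' ss; set y := z *: x - _.
have np : 0 < n%:R :> R by rewrite ltr0n.
have C0 : 0 <= C by exact: ritt_constant_ge0.
have s0 : 0 <= s by lra.
have s0' : 0 <= s' by lra.
pose N := n%:R * C * rnorm y.
have N0 : 0 <= N by rewrite !mulr_ge0 ?rnorm_ge0// ltW.
have K0 : 0 <= ritt_K s z by exact: ritt_K_ge0.
have bound k : rnorm (trig_poly k x) <= N * (n%:R * rnorm (root k - 1))^-1.
  have := boundary_lower_bound Tr (rnorm_cis _) (circle_root_neq1 k) (trig_poly k x).
  rewrite trig_poly_commute trig_poly_resolvent rnormZ_unit ?rnorm_cis//.
  move/le_trans; apply; rewrite le_eqVlt; apply/orP; left; apply/eqP.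
  have r0 : rnorm (root k - 1) != 0.
    by rewrite gt_eqF// rnorm_gt0// subr_eq0 circle_root_neq1.
  by rewrite /N -/C -/y; field; rewrite r0 gt_eqF.
have sumb : \sum_(k < n) rnorm (trig_poly k x) `^ s <= (N * ritt_K s z) `^ s.
  apply: (@le_trans _ _ (\sum_(k < n) N `^ s * (n%:R * rnorm (root k - 1))^-1 `^ s)).
    apply: ler_sum => k _; rewrite -powRM ?invr_ge0 ?mulr_ge0 ?rnorm_ge0//.
    by apply: ler_powRl => //; exact: rnorm_ge0.
  by rewrite -mulr_sumr powRM// ler_wpM2l ?powR_ge0// circle_root_sum.
have := ft n t (fun k => trig_poly k x) n0.
under eq_bigr do rewrite trig_poly_inversion rnormZ rnormM rnorm_cis mulr1.
have -> : rnorm (n%:R : R[i]) = n%:R.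
  by rewrite -(rmorph_nat (real_complex R)) rnormC.
move=> h.
have {}h : n%:R * (n%:R * rnorm (iter n T x)) `^ s' <= n%:R * (N * ritt_K s z) `^ s'.
  apply: le_trans (le_trans _ h) _.
    rewrite [leLHS](_ : _ = \sum_(j < n) (n%:R * rnorm (iter n T x)) `^ s'); last first.
      by rewrite sumr_const card_ord mulr_natl.
    apply: ler_sum => j _; apply: ler_powRl => //.
      by rewrite mulr_ge0 ?rnorm_ge0// ltW.
    by rewrite ler_pM2l//; apply: rnorm_iter_le; exact: ltnW.
  rewrite ler_pM2l// -{2}ss powRrM; apply: ler_powRl; [lra| |exact: sumb].
  by apply: sumr_ge0 => k _; exact: powR_ge0.
move: h; rewrite ler_pM2l// => h.
have sn0 : s' != 0 by lra.
have a0 : 0 <= n%:R * rnorm (iter n T x) by rewrite mulr_ge0 ?rnorm_ge0// ltW.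
have V0 : 0 <= s'^-1 by rewrite invr_ge0.
have := ler_powRl V0 (powR_ge0 _ _) h; rewrite (powRVK a0 sn0) (powRVK (mulr_ge0 N0 K0) sn0).
have -> : N * ritt_K s z = n%:R * (C * ritt_K s z * rnorm y) by rewrite /N; ring.
by rewrite ler_pM2l.
Qed.

Lemma power_lower_bound (s s' : R) x : fourier_type s s' -> 1 < s -> 1 < s' ->
  s * (s' - 1) = s' ->
  rnorm x <= (1 + C * ritt_K s z) * rnorm (z *: x - iter n T x).
Proof.
move=> ft s1 s1' ss; rewrite mulrDl mul1r -(rnormZ_unit x (rnorm_cis t)).
rewrite -{1}[z *: x](subrK (iter n T x)).
apply: le_trans (ler_rnormD _ _) _; rewrite lerD2l.
exact: power_norm_bound ft _ _ _.
Qed.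

End power.
End RittContraction.

(** * Uniform convexity from Fourier type *)

Section Convexity.
Context {R : realType} {V : normedModType R[i]}.
Implicit Types x y : V.

(** Fourier type for [n = 2], where the roots of 1 are [1] and [-1]. *)
Lemma clarkson (s s' : R) x y : @fourier_type R V s s' ->
  rnorm (x + y) `^ s' + rnorm (x - y) `^ s' <=
  2 * (rnorm x `^ s + rnorm y `^ s) `^ (s' - 1).
Proof.
move=> ft; have r0 : circle_root 2 (0 : R) 0 = 1.
  by rewrite /circle_root mulr0 addr0 mul0r cis0.
have r1 : circle_root 2 (0 : R) 1 = -1.
  rewrite /circle_root add0r mulr1 mulrAC divff// mul1r /cis cospi sinpi.
  by apply/eqP; rewrite eq_complex/= oppr0 !eqxx.
have := ft 2%N 0 (fun k : 'I_2 => if k == ord0 then x else y) isT.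
rewrite !big_ord_recl !big_ord0/= !addr0 /bump/= addn0 r0 r1.
by rewrite !expr0 !expr1 !scale1r scaleN1r.
Qed.

(** Clarkson's inequality gives [|(x + y) / 2|^s' <= 1 - (e / 2)^s'].  The pair of
    vectors is asked for because the infimum of the empty set is 0. *)
Lemma modulus_pos (s s' e : R) : @fourier_type R V s s' -> 0 <= s -> 1 < s' -> 0 < e ->
  (exists x y, [/\ rnorm x <= 1, rnorm y <= 1 & e <= rnorm (x - y)]) ->
  0 < modulus_of_convexity V e.
Proof.
move=> ft sge0 s1 e0 [x0 [y0 [x01 y01 xy0]]].
have sn0 : s' != 0 by lra.
have s0 : 0 <= s' by lra.
have V0 : 0 <= s'^-1 by rewrite invr_ge0.
have h2 : rnorm (2^-1 : R[i]) = 2^-1.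
  rewrite (_ : 2^-1 = real_complex R 2^-1); first by rewrite rnormC.
  by rewrite fmorphV/= rmorph_nat.
pose a := (e / 2) `^ s'.
have a0 : 0 < a by apply: powR_gt0; exact: divr_gt0.
have mid x y : rnorm x <= 1 -> rnorm y <= 1 -> e <= rnorm (x - y) ->
    rnorm (2^-1 *: (x + y)) `^ s' <= 1 - a.
  move=> x1 y1 exy; rewrite rnormZ h2 powRM ?rnorm_ge0//.
  have s1pos : 0 <= s' - 1 by lra.
  have up : rnorm (x + y) `^ s' + rnorm (x - y) `^ s' <= 2 `^ s'.
    apply: le_trans (clarkson x y ft) _.
    rewrite -[leRHS](@mulr_powRB1 _ 2 s')//; last lra.
    rewrite ler_wpM2l//; apply: ler_powRl => //; first by rewrite addr_ge0 ?powR_ge0.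
    have le1 z : rnorm z <= 1 -> rnorm z `^ s <= 1 :> R.
      move=> z1; rewrite -[leRHS](_ : 1 `^ s = 1); last by rewrite powR1.
      by apply: ler_powRl => //; exact: rnorm_ge0.
    by apply: lerD; exact: le1.
  have lo : e `^ s' <= rnorm (x - y) `^ s' by apply: ler_powRl => //; exact: ltW.
  have c : 2^-1 `^ s' * 2 `^ s' = 1 :> R by rewrite -powRM// mulVf// powR1.
  have aE : a = 2^-1 `^ s' * e `^ s' by rewrite /a mulrC powRM// ltW.
  rewrite aE lerBrDr -[leRHS]c -mulrDr ler_wpM2l ?powR_ge0//.
  by apply: le_trans up; rewrite lerD2l.
have a1 : 0 <= 1 - a by apply: le_trans (mid _ _ x01 y01 xy0); exact: powR_ge0.
pose m := (1 - a) `^ s'^-1.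
have m1 : m < 1.
  rewrite /m -[ltRHS](_ : 1 `^ s'^-1 = 1); last by rewrite powR1.
  by apply: gt0_ltr_powR; rewrite ?nnegrE ?invr_gt0//; lra.
apply: (@lt_le_trans _ _ (1 - m)); first by rewrite subr_gt0.
apply: lb_le_inf; first by exists (1 - rnorm (2^-1 *: (x0 + y0))), x0, y0.
move=> _ [x [y [x1 y1 xy ->]]]; rewrite lerD2l lerN2.
rewrite -[leLHS](powRVK (rnorm_ge0 _) sn0).
by apply: ler_powRl => //; [exact: powR_ge0|exact: mid].
Qed.

Lemma modulus_le (e : R) x y : rnorm x <= 1 -> rnorm y <= 1 -> e <= rnorm (x - y) ->
  rnorm (x + y) <= 2 * (1 - modulus_of_convexity V e).
Proof.
move=> x1 y1 xy.
have h2 : rnorm (2^-1 : R[i]) = 2^-1.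
  rewrite (_ : 2^-1 = real_complex R 2^-1); first by rewrite rnormC.
  by rewrite fmorphV/= rmorph_nat.
have : modulus_of_convexity V e <= 1 - rnorm (2^-1 *: (x + y)).
  apply: ge_inf; last by exists x, y.
  exists 0 => _ [u [v [u1 v1 _ ->]]].
  rewrite subr_ge0 rnormZ h2; have := ler_rnormD u v; lra.
by rewrite rnormZ h2; lra.
Qed.

End Convexity.

(** * Ritt contractions on L^p *)

(** The kernel is a twisted Fourier matrix, whose rows have squared length [n]. *)
Lemma cLp_fourier_type (R : realType) (d : measure_display)
    (T : measurableType d) (mu : {measure set T -> \bar R}) (p p' : R) (p1 : 1 < p) :
  p^-1 + p'^-1 = 1 ->
  @fourier_type R (cLp mu (ltW p1)) (Num.min p p') (Num.max p p').
Proof.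
move=> pp' n t x n0.
have L0 : 0 < n%:R :> R by rewrite ltr0n.
have W1 (j k : 'I_n) : rnorm (circle_root n t k ^+ j) <= 1.
  by rewrite rnorm_circle_rootX.
exact: (vector_hausdorff_young L0 (circle_root_ortho t n0) W1 x p1 pp').
Qed.

Theorem theorem9p6 (R : realType) (d : measure_display)
    (Omega : measurableType d) (nu : {sigma_finite_measure set Omega -> \bar R})
    (p p' : R) (p1 : 1 < p) (pp' : p^-1 + p'^-1 = 1)
    (Lp_neq0 : exists f : cLp nu (ltW p1), f != 0)
    (T : cLp nu (ltW p1) -> cLp nu (ltW p1))
    (T_contraction : contraction_op T) (T_ritt : ritt_operator T) :
  let C : R := fine (ritt_constant T) in
  let pstar : R := Num.min p p' in
  let bound : R :=
    2 * (1 - modulus_of_convexity (cLp nu (ltW p1))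
               (1 + C * ritt_K pstar (-1))^-1) in
  (forall zeta : R[i], rnorm zeta = 1 -> zeta != 1 ->
     (forall n : nat, (1 <= n)%N -> resolvent_set (iter n T) zeta) /\
     (ereal_sup [set opnorm (resolvent (iter n T) zeta)
                | n in [set n : nat | (1 <= n)%N]]
       <= (1 + C * ritt_K pstar zeta)%:E)%E) /\
  (ereal_sup [set opnorm (fun x : cLp nu (ltW p1) => (x - iter n T x)%R)
             | n in [set n : nat | (1 <= n)%N]] <= bound%:E)%E /\
  bound < 2.
Proof.
move=> C s bound; set X := cLp nu (ltW p1) in Lp_neq0 T T_contraction T_ritt C bound *.
pose s' := Num.max p p'.
have ft : @fourier_type R X s s' by exact: cLp_fourier_type.
have compl : @series_complete R X by exact: cLp_series_converges.
have pn0 : p != 0 by rewrite gt_eqF// (lt_trans ltr01).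
have p10 : p - 1 != 0 by rewrite subr_eq0 gt_eqF.
have p'E : p' = p / (p - 1).
  have : p'^-1 = (p - 1) / p by apply: (addrI p^-1); rewrite pp'; field.
  by move=> /(congr1 GRing.inv); rewrite invrK invf_div.
have p'1 : 1 < p' by rewrite p'E ltr_pdivlMr ?subr_gt0// mul1r gtrBl.
have s1 : 1 < s by rewrite lt_min p1.
have s1' : 1 < s' by rewrite lt_max p1.
have ss : s * (s' - 1) = s'.
  have e : p * p' = p + p' by rewrite p'E; field.
  by rewrite /s /s'; case: leP => _; rewrite mulrBr mulr1 ?[p' * p]mulrC e;
    [rewrite addrAC subrr add0r|rewrite addrK].
have C0 : 0 <= C by exact: ritt_constant_ge0.
have M1 z : 1 <= 1 + C * ritt_K s z by rewrite lerDl mulr_ge0// ritt_K_ge0.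
have M0 z : 0 <= 1 + C * ritt_K s z by rewrite (le_trans ler01).
have lower (z : R[i]) n : rnorm z = 1 -> z != 1 -> (1 <= n)%N ->
    forall x : X, rnorm x <= (1 + C * ritt_K s z) * rnorm (z *: x - iter n T x).
  move=> z1 zn1 n1 x; have [t [t0 t2 ->]] := unit_circle_cis z1 zn1.
  by apply: (power_lower_bound T_contraction T_ritt n1 _ x ft s1 s1' ss); rewrite t0.
split=> [z z1 zn1|].
  have res n : (1 <= n)%N -> resolvent_set (iter n T) z.
    move=> n1; apply: (@bounded_inverse_of_lower_bound _ _ _ _ _ (M0 z) (lower z n z1 zn1 n1)).
      move=> a x y; rewrite (linear_iter T_contraction).
      by rewrite scalerBr scalerDr !scalerA [z * a]mulrC opprD addrACA.
    have [t [t0 t2 ->]] := unit_circle_cis z1 zn1.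
    by apply: power_surjective => //; rewrite t0.
  split=> //; apply: ge_ereal_sup => _ [n /= n1 <-].
  by apply: opnorm_resolvent_le => //; [exact: res|exact: lower].
have N1 : rnorm (-1 : R[i]) = 1 by rewrite rnormN /rnorm normr1.
have N1n : (-1 : R[i]) != 1 by rewrite eq_complex/= oppr0 eqxx andbT -subr_eq0; lra.
set e := (1 + C * ritt_K s (-1))^-1 in bound *.
have e0 : 0 < e by rewrite invr_gt0 (lt_le_trans ltr01).
(* The lower bound for -1, read as a distance in the unit ball. *)
have far n (x : X) : (1 <= n)%N -> rnorm x = 1 -> e <= rnorm (x - - iter n T x).
  move=> n1 x1; have := lower (-1) n N1 N1n n1 x.
  rewrite x1 scaleN1r -opprD rnormN opprK => h.
  by rewrite /e -[leLHS]mul1r ler_pdivrMr ?(lt_le_trans ltr01)// mulrC.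
have small n (x : X) : rnorm x <= 1 -> rnorm (- iter n T x) <= 1.
  by move=> x1; rewrite rnormN; apply: le_trans (rnorm_iter_le T_contraction x (leq0n n)) _.
have key n (x : X) : (1 <= n)%N -> rnorm x = 1 -> rnorm (x - iter n T x) <= bound.
  move=> n1 x1; apply: modulus_le; first by rewrite x1.
    by apply: small; rewrite x1.
  exact: far.
have [f fn0] := Lp_neq0; have f1 := unit_vector fn0.
set u := _ *: f in f1.
have b0 : 0 <= bound by apply: le_trans (key 1%N u _ f1); rewrite ?rnorm_ge0.
split.
  apply: ge_ereal_sup => _ [n /= n1 <-]; apply/opnorm_leP => //.
    move=> a x y; rewrite (linear_iter T_contraction).
    by rewrite scalerBr opprD addrACA.
  move=> x; have [->|xn0] := eqVneq x 0.
    by rewrite (linop0 (linear_iter T_contraction n)) subr0 rnorm0 mulr0.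
  have := key n _ n1 (unit_vector xn0); have xp := rnorm_gt0 xn0.
  rewrite (linopZ (linear_iter T_contraction n)) -scalerBr rnormZ rnormC.
    by rewrite mulrC ler_pdivrMr.
  by rewrite invr_ge0 ltW.
suff : 0 < modulus_of_convexity X e by rewrite /bound; lra.
apply: (modulus_pos ft (ltW (lt_trans ltr01 s1)) s1' e0); exists u, (- iter 1 T u); split; last exact: far.
- by rewrite f1.
- by apply: small; rewrite f1.
Qed.
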